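(* Let $\mathcal{A}$ be the set of all finite simple graphs $G$ with the property $\mathrm{reg}(R/I(G))=a(G)$. Then $\mathcal{A}$ is closed under product of graphs, i.e. for any $G,H\in\mathcal{A}$ (with disjoint vertex sets) one has $$\mathrm{reg}(R/I(G*H))=a(G*H).$$
   Context: $\mathbb{K}$ is a field. For a finite simple graph $G$ with vertex set $V(G)=\{x_1,\dots,x_n\}$ and edge set $E(G)$, the edge ideal $I(G)$ is the ideal generated by the monomials $x_ix_j$ with $\{x_i,x_j\}\in E(G)$ in the polynomial ring $R$ over $\mathbb{K}$ whose variables are the vertices of the graph in question. For a finitely generated graded $R$-module $M$ with graded Betti numbers $\beta_{i,j}(M)$, $\mathrm{reg}(M)=\max\{j-i \mid \beta_{i,j}(M)\neq 0\}$. Two edges $\{x,y\}$ and $\{u,v\}$ of $G$ are called 3-disjoint if the induced subgraph of $G$ on $\{x,y,u,v\}$ is disconnected. A set $\Gamma$ of edges of $G$ is a pairwise 3-disjoint set of edges if any pair of (distinct) edges of $\Gamma$ is 3-disjoint. $a(G)$ denotes the maximum cardinality of a pairwise 3-disjoint set of edges in $G$. For graphs $G,H$ with $V(G)\cap V(H)=\emptyset$, the product $G*H$ is the graph on $V(G)\cup V(H)$ with edge set $E(G)\cup E(H)\cup\{\{x,y\}\mid x\in V(G),\ y\in V(H)\}$. *)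

(* Defs.v *)
From mathcomp Require Import all_boot all_order all_algebra.
From mathcomp Require Import mpoly.

Set Implicit Arguments.
Unset Strict Implicit.
Unset Printing Implicit Defensive.

Import GRing.Theory.
Local Open Scope ring_scope.

Record sgraph := SGraph {
  vertex :> finType;
  adj : rel vertex;
  adj_sym : ssrbool.symmetric adj;
  adj_irrefl : ssrbool.irreflexive adj }.

Definition edges (G : sgraph) : {set {set G}} :=
  [set [set p.1; p.2] | p : G * G & adj p.1 p.2].

Definition induced_rel (G : sgraph) (A : {set G}) : rel G :=
  [rel x y | [&& x \in A, y \in A & adj x y]].

Definition induced_disconnected (G : sgraph) (A : {set G}) : bool :=
  [exists x in A, exists y in A, ~~ connect (induced_rel A) x y].

Definition three_disjoint (G : sgraph) (e f : {set G}) : bool :=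
  induced_disconnected (e :|: f).

Definition pairwise_three_disjoint (G : sgraph) (Gam : {set {set G}}) : bool :=
  (Gam \subset edges G) &&
  [forall e in Gam, forall f in Gam, (e != f) ==> three_disjoint e f].

Definition max_three_disjoint (G : sgraph) : nat :=
  \max_(Gam : {set {set G}} | pairwise_three_disjoint Gam) #|Gam|.

(* The disjointness of the two vertex sets is built into the sum type. *)
Definition prod_adj (G H : sgraph) : rel (G + H)%type :=
  fun u v => match u, v with
    | inl x, inl y => adj x y
    | inr x, inr y => adj x y
    | _, _ => true
    end.

Lemma prod_adj_sym (G H : sgraph) : ssrbool.symmetric (@prod_adj G H).
Proof. by move=> [x|x] [y|y] //=; rewrite adj_sym. Qed.

Lemma prod_adj_irrefl (G H : sgraph) : ssrbool.irreflexive (@prod_adj G H).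
Proof. by move=> [x|x] /=; rewrite adj_irrefl. Qed.

Definition graph_prod (G H : sgraph) : sgraph :=
  SGraph (@prod_adj_sym G H) (@prod_adj_irrefl G H).

Definition ideal_gen (R : comNzRingType) (gens : R -> Prop) (p : R) : Prop :=
  exists s : seq (R * R),
    (forall cg, cg \in s -> gens cg.2) /\ p = \sum_(cg <- s) cg.1 * cg.2.

(* The variable of the vertex x is 'X_(enum_rank x). *)
Definition edge_ideal (K : fieldType) (G : sgraph) :
    {mpoly K[#|G|]} -> Prop :=
  ideal_gen (fun g => exists x y : G,
    adj x y /\ g = 'X_(enum_rank x) * 'X_(enum_rank y)).
Arguments edge_ideal : clear implicits.

(* Data of a sequence of graded free modules over R = K[x_1..x_n]
     ... -> F_2 -> F_1 -> F_0 -> R/I.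
   F_i is the module of row vectors of length fr_rank i, whose k-th basis
   vector has degree fr_deg i k; the map F_{i+1} -> F_i is right
   multiplication by fr_diff i, and F_0 -> R/I is right multiplication by
   fr_aug followed by reduction modulo I. *)
Record free_seq (K : fieldType) (n : nat) := FreeSeq {
  fr_rank : nat -> nat;
  fr_deg : forall i, 'I_(fr_rank i) -> nat;
  fr_diff : forall i, 'M[{mpoly K[n]}]_(fr_rank i.+1, fr_rank i);
  fr_aug : 'cV[{mpoly K[n]}]_(fr_rank 0) }.

Arguments fr_rank {K n} F i : rename.
Arguments fr_deg {K n} F {i} k : rename.
Arguments fr_diff {K n} F i : rename.
Arguments fr_aug {K n} F : rename.

Section Resolutions.
Variables (K : fieldType) (n : nat).
Implicit Types (F : free_seq K n) (I : {mpoly K[n]} -> Prop).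

(* All maps have degree 0: an entry of fr_diff i is homogeneous of degree
   fr_deg i.+1 k - fr_deg i l, and is 0 when this difference is negative. *)
Definition graded_maps F : Prop :=
  (forall k, fr_aug F k 0 \is (fr_deg F k).-homog) /\
  (forall i k l m, m \in msupp (fr_diff F i k l) ->
     (fr_deg F l + mdeg m)%N = fr_deg F k).

Definition resolves F I : Prop :=
  [/\ forall p, exists v : 'rV_(fr_rank F 0), I (p - (v *m fr_aug F) 0 0),
      forall v : 'rV_(fr_rank F 0),
        I ((v *m fr_aug F) 0 0) <-> exists w, v = w *m fr_diff F 0
    & forall i (v : 'rV_(fr_rank F i.+1)),
        v *m fr_diff F i = 0 <-> exists w, v = w *m fr_diff F i.+1].

(* The image of F_{i+1} lies in m F_i, where m = (x_1, ..., x_n). *)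
Definition minimal F : Prop := forall i k l, (fr_diff F i k l)@_0%MM = 0.

Definition minimal_graded_free_resolution F I : Prop :=
  [/\ graded_maps F, resolves F I & minimal F].

(* b i j = beta_{i,j}(R/I), the number of summands R(-j) of F_i in a minimal
   graded free resolution F of R/I. A relation rather than a function because
   no resolution is computed; F is unique up to isomorphism, so b is unique. *)
Definition graded_betti I (b : nat -> nat -> nat) : Prop :=
  exists2 F, minimal_graded_free_resolution F I &
    forall i j, b i j = #|[set k : 'I_(fr_rank F i) | fr_deg F k == j]|.

(* reg(R/I) = r *)
Definition reg_quotient I (r : int) : Prop :=
  exists2 b, graded_betti I b &
    (exists i j, b i j <> 0%N /\ r = j%:Z - i%:Z) /\
    (forall i j, b i j <> 0%N -> j%:Z - i%:Z <= r).

End Resolutions.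

(* Membership in the class A: reg(R/I(G)) = a(G). *)
Definition reg_eq_a (K : fieldType) (G : sgraph) : Prop :=
  reg_quotient (edge_ideal K G) (max_three_disjoint G)%:Z.

(* Main.v *)
Require Import Defs.
From mathcomp Require Import all_boot all_order all_algebra.
From mathcomp Require Import mpoly.
From HB Require Import structures.
From mathcomp Require Import zify.
From Stdlib Require Import ClassicalEpsilon.

Set Implicit Arguments.
Unset Strict Implicit.
Unset Printing Implicit Defensive.

Import GRing.Theory Num.Theory.
Local Open Scope ring_scope.

(** Both sides of the claimed equality obey the same formula: if G and H are
disjoint, then reg R/I(G*H) = max(reg R/I(G), reg R/I(H), c), where c is 1 if
both graphs have a vertex and 0 otherwise, and a(G*H) = max(a(G), a(H), c).

The combinatorial half ([max_three_disjoint_prod]) holds since two distinct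
edges are 3-disjoint exactly when no vertex of one equals or is adjacent to a
vertex of the other ([three_disjointE]).  In G*H every vertex of G is adjacent
to every vertex of H, so a pairwise 3-disjoint set with two or more edges lies
inside G or inside H.

For the algebraic half ([reg_edge_ideal_prod]) a minimal graded free resolution
of S/J, with J = I(G*H) and S the polynomial ring on all the vertices, is built
from the given ones.  Let x and y denote the variables of G and of H, and
L = (x)(y), so that J = I(G) + I(H) + L.  The three ingredients are as follows.
- S/L has a linear resolution ([bipartite_resolution]): adding one variable y
  at a time, (x)(y_1..y_k+1) / (x)(y_1..y_k) is a copy of
  (x) / (x)(y_1..y_k), shifted by one degree.
- (I(G) + L)/L is isomorphic to I(G)/(y)I(G), because I(G) lies in (x).  Its
  resolution comes from the one of R/I(G) by dropping the term of degree 0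
  ([min_resolves_truncate]), extending the ring ([min_resolves_base_change])
  and killing the regular sequence y by mapping cones
  ([min_resolves_koszul]); see [extended_edge_resolution].  The same holds
  for H.
- J/L is the direct sum of (I(G) + L)/L and (I(H) + L)/L, because a monomial
  in both I(G) and I(H) is in L.  The mapping cone ([min_resolves_cone]) of a
  comparison map from the resolution of J/L to that of S/L resolves S/J.

This cone is minimal for degree reasons.  Edge ideals start in degree 2, so in
homological degree i the resolution of J/L has generators in degrees at least
i+2, while that of S/L has generators in degrees at most i+1; hence no entry of
a comparison map is a nonzero constant.  No cancellation occurs, and the values
of (degree minus homological degree) in the cone are exactly those for S/L and
those for J/L lowered by 1; this is what the predicate [has_shift] records.

All ideals that occur are spanned by monomials, so ideal membership is a
condition on the support of a polynomial, and ideals are represented by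
predicates on exponent vectors. *)

(** * Polynomials supported on a set of monomials *)
Section MonomialSpaces.
Variables (K : fieldType) (n : nat).
Implicit Types (p q r : {mpoly K[n]}) (Q : pred 'X_{1..n}).

Section LinearExtension.
Variables (V : lmodType K) (g : 'X_{1..n} -> V).

Definition mlin p : V := \sum_(m <- msupp p) p@_m *: g m.

Lemma mlin_widen p (s : seq 'X_{1..n}) : uniq s -> {subset msupp p <= s} ->
  mlin p = \sum_(m <- s) p@_m *: g m.
Proof.
move=> us ps; rewrite (bigID (mem (msupp p))) /= [X in _ + X]big1 ?addr0; last first.
  by move=> m /memN_msupp_eq0->; rewrite scale0r.
rewrite -big_filter; apply: perm_big.
apply: uniq_perm; rewrite ?filter_uniq ?msupp_uniq //.
by move=> m; rewrite mem_filter; case: (boolP (m \in msupp p)) => // /ps ->.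
Qed.

Lemma mlin_is_linear : linear mlin.
Proof.
move=> c p q; pose s := undup (msupp (c *: p + q) ++ msupp p ++ msupp q).
have sub t : {subset t <= msupp (c *: p + q) ++ msupp p ++ msupp q} -> {subset t <= s}.
  by move=> h m /h; rewrite mem_undup.
have us : uniq s by apply: undup_uniq.
have s1 : {subset msupp (c *: p + q) <= s}.
  by apply: sub => m; rewrite !mem_cat => ->.
have s2 : {subset msupp p <= s}.
  by apply: sub => m; rewrite !mem_cat => ->; rewrite orbT.
have s3 : {subset msupp q <= s}.
  by apply: sub => m; rewrite !mem_cat => ->; rewrite !orbT.
rewrite (mlin_widen us s1) (mlin_widen us s2) (mlin_widen us s3).
rewrite scaler_sumr -big_split; apply: eq_bigr => m _ /=.
by rewrite mcoeffD mcoeffZ scalerDl scalerA.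
Qed.

HB.instance Definition _ :=
  GRing.isLinear.Build K {mpoly K[n]} V *:%R mlin mlin_is_linear.

Lemma mlinX m : mlin 'X_[m] = g m.
Proof. by rewrite /mlin msuppX big_seq1 mcoeffX eqxx scale1r. Qed.

End LinearExtension.

(** The part of a polynomial supported on [Q].  It serves both to split along a
monomial ideal and to extract homogeneous components. *)
Definition mpart Q := mlin (fun m => if Q m then 'X_[K, m] else 0).
HB.instance Definition _ Q := GRing.Linear.on (mpart Q).

Lemma mcoeff_mpart Q p m : (mpart Q p)@_m = if Q m then p@_m else 0.
Proof.
rewrite [in RHS](mpolyE p) /mpart /mlin !raddf_sum /=.
case: ifPn => Qm; last first.
  apply: big1 => k _; rewrite mcoeffZ; case: ifP => Qk; rewrite ?mcoeff0 ?mulr0 //.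
  by rewrite mcoeffX; case: eqP Qm => [<-|]; rewrite ?Qk ?mulr0.
apply: eq_bigr => k _; rewrite !mcoeffZ mcoeffX.
case: ifP => Qk; rewrite ?mcoeffX ?mcoeff0 //.
by case: eqP Qk => [->|]; rewrite ?Qm.
Qed.

Lemma mpartX Q m : mpart Q 'X_[m] = if Q m then 'X_[m] else 0.
Proof. exact: mlinX. Qed.

Lemma msupp_mpart Q p m : m \in msupp (mpart Q p) = Q m && (m \in msupp p).
Proof. by rewrite !mcoeff_msupp mcoeff_mpart; case: (Q m); rewrite ?eqxx. Qed.

Lemma mpart_id Q p : {in msupp p, forall m, Q m} -> mpart Q p = p.
Proof.
move=> Qp; apply/mpolyP => m; rewrite mcoeff_mpart.
case: ifPn => // nQ; apply/esym/eqP; rewrite mcoeff_eq0.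
by apply: contra nQ => /Qp.
Qed.

(** With [Q] and [Q'] prescribing degrees, this says that multiplication by a
homogeneous [q] commutes with taking homogeneous components. *)
Lemma mpart_mul Q Q' p q :
  (forall m m', m' \in msupp q -> Q' (m + m')%MM = Q m) ->
  mpart Q' (p * q) = mpart Q p * q.
Proof.
move=> h; rewrite [in LHS](mpolyE p) mulr_suml raddf_sum /=.
rewrite [in RHS]/mpart /mlin mulr_suml; apply: eq_bigr => m _.
rewrite -!scalerAl linearZ /=; congr (_ *: _).
rewrite {1}(mpolyE q) mulr_sumr raddf_sum /=.
have -> : (if Q m then 'X_[K, m] else 0) * q =
    \sum_(k <- msupp q) if Q m then q@_k *: 'X_[m + k] else 0.
  case: (Q m); last by rewrite mul0r big1.
  rewrite {1}(mpolyE q) mulr_sumr; apply: eq_bigr => k _.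
  by rewrite -scalerAr mpolyXD.
apply: eq_big_seq => k kq; rewrite -scalerAr linearZ /= -mpolyXD mpartX h //.
by case: (Q m); rewrite ?scaler0.
Qed.

Definition mon_span Q p : Prop := {in msupp p, forall m, Q m}.

Record ideal_like (I : {mpoly K[n]} -> Prop) : Prop := IdealLike {
  ideal0 : I 0;
  idealD : forall p q, I p -> I q -> I (p + q);
  idealM : forall r p, I p -> I (r * p) }.

Lemma idealN I p : ideal_like I -> I p -> I (- p).
Proof. by move=> Ii Ip; rewrite -mulN1r; apply: idealM. Qed.

Lemma idealB I p q : ideal_like I -> I p -> I q -> I (p - q).
Proof. by move=> Ii Ip Iq; apply: idealD => //; apply: idealN. Qed.

Lemma ideal_sum I (J : eqType) (s : seq J) (f : J -> {mpoly K[n]}) : ideal_like I ->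
  (forall j, j \in s -> I (f j)) -> I (\sum_(j <- s) f j).
Proof.
move=> Ii h; rewrite big_seq; elim/big_ind: _ => //.
  exact: ideal0. exact: idealD.
Qed.

Definition homogeneous_ideal (I : {mpoly K[n]} -> Prop) : Prop :=
  forall e p, I p -> I (mpart (fun m => mdeg m == e) p).

Lemma mon_span_ideal Q : (forall m m', Q m -> Q (m + m')%MM) -> ideal_like (mon_span Q).
Proof.
move=> Qup; split.
- by move=> m; rewrite msupp0.
- move=> p q Qp Qq m /msuppD_le; rewrite mem_cat => /orP[]; [exact: Qp|exact: Qq].
- move=> r p Qp m /msuppM_le /allpairsP[[a b] /= [_ bp ->]].
  by rewrite addmC; apply/Qup/Qp.
Qed.

Lemma mon_span_homogeneous Q : homogeneous_ideal (mon_span Q).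
Proof. by move=> e p Qp m; rewrite msupp_mpart => /andP[_ /Qp]. Qed.

Lemma mon_spanS Q Q' p : (forall m, Q m -> Q' m) -> mon_span Q p -> mon_span Q' p.
Proof. by move=> QQ Qp m /Qp /QQ. Qed.

Lemma mpart_split Q p : p = mpart Q p + mpart (predC Q) p.
Proof.
apply/mpolyP => m; rewrite mcoeffD !mcoeff_mpart /=.
by case: (Q m); rewrite ?addr0 ?add0r.
Qed.

Lemma mon_spanMX Q p u :
  mon_span Q ('X_[u] * p) <-> mon_span (fun m => Q (u + m)%MM) p.
Proof.
rewrite mulrC; split=> h m mp.
  by apply: h; rewrite (perm_mem (msuppMX _ _)) map_f.
move: mp; rewrite (perm_mem (msuppMX _ _)) => /mapP[k kp ->].
exact: h.
Qed.

End MonomialSpaces.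
(** * Complexes resolving a subquotient of the polynomial ring *)
Section Resolutions.
Variables (K : fieldType) (n : nat).
Implicit Types (F G : free_seq K n) (A B I P : {mpoly K[n]} -> Prop).
Implicit Types (p q : {mpoly K[n]}).

Definition augment F (v : 'rV_(fr_rank F 0)) : {mpoly K[n]} := (v *m fr_aug F) 0 0.

Definition acyclic F : Prop := forall i (v : 'rV_(fr_rank F i.+1)),
  v *m fr_diff F i = 0 <-> exists w, v = w *m fr_diff F i.+1.

(** Exactness of ... -> F_1 -> F_0 -> A/I -> 0 for ideals I inside A, where the
last map sends v to the class of [augment v].  Modules thus never appear as
objects: A/I is handled through polynomials. *)
Definition resolves_quot F A I : Prop :=
  [/\ forall p, A p <-> exists v : 'rV_(fr_rank F 0), I (p - augment v),
      forall v : 'rV_(fr_rank F 0), I (augment v) <-> exists w, v = w *m fr_diff F 0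
    & acyclic F].

Lemma resolves_quot_ext F A I A' I' :
  (forall p, A p <-> A' p) -> (forall p, I p <-> I' p) ->
  resolves_quot F A I -> resolves_quot F A' I'.
Proof.
move=> AA II [h1 h2 h3]; split=> //.
  move=> p; rewrite -AA h1; split=> -[v hv]; exists v; exact/II.
by move=> v; rewrite -II.
Qed.

Lemma augmentD F u v : augment (u + v : 'rV_(fr_rank F 0)) = augment u + augment v.
Proof. by rewrite /augment mulmxDl mxE. Qed.

Lemma augmentN F u : augment (- u : 'rV_(fr_rank F 0)) = - augment u.
Proof. by rewrite /augment mulNmx mxE. Qed.

Lemma augmentZ F p u : augment (p *: u : 'rV_(fr_rank F 0)) = p * augment u.
Proof. by rewrite /augment -scalemxAl mxE. Qed.

Lemma augment0 F : augment (0 : 'rV_(fr_rank F 0)) = 0.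
Proof. by rewrite /augment mul0mx mxE. Qed.

Lemma augment_delta F k : augment (delta_mx 0 k : 'rV_(fr_rank F 0)) = fr_aug F k 0.
Proof. by rewrite /augment -rowE mxE. Qed.

Lemma acyclic_dd F i : acyclic F -> fr_diff F i.+1 *m fr_diff F i = 0.
Proof.
move=> aF; apply/row_matrixP => k; rewrite row_mul row0.
by apply/aF; exists (delta_mx 0 k); rewrite rowE.
Qed.

Lemma resolves_quot_sub F A I p : resolves_quot F A I -> I p -> A p.
Proof. by case=> h _ _ Ip; apply/h; exists 0; rewrite augment0 subr0. Qed.

Lemma resolves_quot_augment F A I (v : 'rV_(fr_rank F 0)) :
  ideal_like I -> resolves_quot F A I -> A (augment v).
Proof. by move=> Ii [h _ _]; apply/h; exists v; rewrite subrr; apply: ideal0. Qed.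

Definition graded_mx a b (dr : 'I_a -> nat) (dc : 'I_b -> nat)
    (M : 'M[{mpoly K[n]}]_(a, b)) : Prop :=
  forall k l m, m \in msupp (M k l) -> (dc l + mdeg m)%N = dr k.

Lemma graded_mapsE F : graded_maps F <->
  graded_mx (fr_deg F (i:=0)) (fun=> 0%N) (fr_aug F) /\
  forall i, graded_mx (fr_deg F (i:=i.+1)) (fr_deg F (i:=i)) (fr_diff F i).
Proof.
split=> [] [h1 h2]; split=> //.
  by move=> k l m; rewrite ord1; move/dhomogP: (h1 k) => h /h.
by move=> k; apply/dhomogP => m /h1.
Qed.

(** * Mapping cones *)

(** In homological degree i+1 the cone of [phi : F -> G] is F_i (degrees raised
by [s]) plus G_(i+1).  The clause for homological degree 0 is separate, as F
contributes nothing there. *)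
Section Cone.
Variables (s : nat) (F G : free_seq K n).
Variable (phi : forall i, 'M[{mpoly K[n]}]_(fr_rank F i, fr_rank G i)).

Definition cone_rank i : nat :=
  if i is j.+1 then (fr_rank F j + fr_rank G j.+1)%N else fr_rank G 0.

Definition cone_deg i : 'I_(cone_rank i) -> nat :=
  match i return 'I_(cone_rank i) -> nat with
  | 0 => fun k => fr_deg G k
  | j.+1 => fun k => match split k with
                     | inl a => (fr_deg F a + s)%N
                     | inr b => fr_deg G b
                     end
  end.

Definition cone_diff i : 'M[{mpoly K[n]}]_(cone_rank i.+1, cone_rank i) :=
  match i return 'M[{mpoly K[n]}]_(cone_rank i.+1, cone_rank i) with
  | 0 => col_mx (phi 0) (fr_diff G 0)
  | j.+1 => block_mx (- fr_diff F j) (phi j.+1) 0 (fr_diff G j.+1)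
  end.

Definition cone : free_seq K n :=
  @FreeSeq K n cone_rank cone_deg cone_diff (fr_aug G).

Definition chain_map : Prop :=
  forall i, fr_diff F i *m phi i = phi i.+1 *m fr_diff G i.

(** Multiplication by [f] embeds A/I into B/P, with cokernel B/(P + fA).  As
[phi] lifts this embedding, the long exact sequence of the cone has homology
only in degree 0, where it is that cokernel; the proof is the diagram chase. *)
Lemma cone_resolves A I B P P' f :
  ideal_like I -> ideal_like P ->
  resolves_quot F A I -> resolves_quot G B P -> chain_map ->
  (forall v, P (augment (v *m phi 0) - f * augment v)) ->
  (forall a, A a -> B (f * a)) ->
  (forall a, A a -> (P (f * a) <-> I a)) ->
  (forall p, P' p <-> exists2 a, A a & P (p - f * a)) ->
  resolves_quot cone B P'.
Proof.
move=> Ii Pi RF RG phiC phi0 fA fP P'E.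
have AF v : A (augment v) := resolves_quot_augment v Ii RF.
have [F1 F2 F3] := RF; have [G1 G2 G3] := RG.
have exact1 (c : 'rV_(fr_rank F 0)) (e : 'rV_(fr_rank G 1)) :
    c *m phi 0 + e *m fr_diff G 0 = 0 -> exists w, c = w *m fr_diff F 0.
  move=> ce0; apply/F2/fP; first exact: AF.
  have Pc : P (augment (c *m phi 0)).
    apply/G2; exists (- e); rewrite mulNmx; apply/eqP.
    by rewrite -addr_eq0 ce0.
  by move: (idealB Pi Pc (phi0 c)); rewrite opprB addrC subrK.
have correct i (c : 'rV_(fr_rank F i)) (e : 'rV_(fr_rank G i.+1)) w :
    c *m phi i + e *m fr_diff G i = 0 -> c = w *m fr_diff F i ->
    exists u, e = - w *m phi i.+1 + u *m fr_diff G i.+1.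
  move=> ce0 cE; have /G3[u uE] : (e + w *m phi i.+1) *m fr_diff G i = 0.
    by rewrite mulmxDl -mulmxA -phiC mulmxA -cE addrC.
  by exists u; rewrite -uE mulNmx addrC addrK.
split.
- move=> p; rewrite G1; split=> -[v].
    by move=> Pv; exists v; apply/P'E; exists 0; rewrite ?mulr0 ?subr0 //; apply/F1;
       exists 0; rewrite augment0 subr0; apply: ideal0.
  case/P'E => a Aa Pa; have /G1[u Pu] := fA a Aa; exists (v + u).
  rewrite augmentD; have := idealD Pi Pa Pu.
  by rewrite addrA subrK -addrA -opprD.
- change (forall v : 'rV_(fr_rank G 0), P' (augment v) <->
    exists w : 'rV_(fr_rank F 0 + fr_rank G 1), v = w *m col_mx (phi 0) (fr_diff G 0)).
  move=> v; split.
    case/P'E => a Aa Pa; have /F1[u Iu] := Aa.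
    have Au : A (a - augment u) by apply: resolves_quot_sub RF Iu.
    have Pu := (fP _ Au).2 Iu.
    have : P (augment (v - u *m phi 0)).
      have := idealB Pi (idealD Pi Pa Pu) (phi0 u).
      rewrite mulrBr addrA subrK opprB addrA subrK => h.
      by rewrite augmentD augmentN.
    case/G2 => w wE; exists (row_mx u w); rewrite mul_row_col.
    by rewrite -wE addrC subrK.
  case=> w vE; apply/P'E.
  rewrite -[w]hsubmxK mul_row_col in vE.
  exists (augment (lsubmx w)) => //.
  rewrite vE augmentD addrAC; apply: idealD => //.
  by apply/G2; eexists.
case=> [|i] v; rewrite -[v](hsubmxK (v : 'rV_(_ + _))) /=;
  move: (lsubmx _) (rsubmx _) => c e.
  rewrite mul_row_col; split=> [ce0|].
    have [w wE] := exact1 _ _ ce0; have [u uE] := correct _ _ _ _ ce0 wE.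
    exists (row_mx (- w) u); rewrite mul_row_block mulmx0 addr0 mulNmx mulmxN opprK.
    by rewrite -wE -uE.
  case=> w; rewrite -(hsubmxK (w : 'rV_(_ + _))) mul_row_block mulmx0 addr0.
  case/eq_row_mx => -> ->; rewrite mulmxDl mulmxN mulNmx -!mulmxA phiC.
  by rewrite (acyclic_dd _ G3) mulmx0 addr0 addNr.
rewrite mul_row_block mulmx0 addr0; split=> [|[w]].
  rewrite -row_mx0 => /eq_row_mx[c0 ce0].
  have /F3[w wE] : c *m fr_diff F i = 0.
    by apply/eqP; rewrite -oppr_eq0 -mulmxN c0.
  have [u uE] := correct _ _ _ _ ce0 wE.
  exists (row_mx (- w) u); rewrite mul_row_block mulmx0 addr0 mulNmx mulmxN opprK.
  by rewrite -wE -uE.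
rewrite -(hsubmxK (w : 'rV_(_ + _))) mul_row_block mulmx0 addr0.
case/eq_row_mx => -> ->; rewrite mulmxN mulmxDl -!mulmxA !mulNmx.
rewrite (acyclic_dd _ F3) (acyclic_dd _ G3) oppr0 !mulmx0 oppr0 addr0.
by rewrite mulmxN phiC addNr row_mx0.
Qed.

End Cone.
End Resolutions.
(** * Degrees of generators, and lifting of chain maps *)
Section Shifts.
Variables (K : fieldType) (n : nat).
Implicit Types (F G : free_seq K n) (A B I P : {mpoly K[n]} -> Prop).
Implicit Types (p q : {mpoly K[n]}).

(** For a minimal resolution, the regularity is the largest such [z]. *)
Definition has_shift F (z : int) : Prop :=
  exists i, exists k : 'I_(fr_rank F i), z = (fr_deg F k)%:Z - i%:Z.

Lemma cone_graded s F G
    (phi : forall i, 'M[{mpoly K[n]}]_(fr_rank F i, fr_rank G i)) :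
  graded_maps F -> graded_maps G ->
  (forall i, graded_mx (fun k => fr_deg F k + s)%N (fr_deg G (i:=i)) (phi i)) ->
  graded_maps (cone s phi).
Proof.
move=> /graded_mapsE[_ Fg] [Ga Gg] phig; split=> // -[|i] k l m /=.
  case: (split_ordP k) => j ->; rewrite ?col_mxEu ?col_mxEd.
    by move/phig.
  by move/Gg.
case: (split_ordP k) => a ->; case: (split_ordP l) => b ->;
  rewrite ?block_mxEul ?block_mxEur ?block_mxEdl ?block_mxEdr ?mxE.
- by rewrite (perm_mem (msuppN _)) => /Fg <-; rewrite addnAC.
- by move/phig.
- by rewrite msupp0.
- by move/Gg.
Qed.

Lemma cone_minimal s F G
    (phi : forall i, 'M[{mpoly K[n]}]_(fr_rank F i, fr_rank G i)) :
  minimal F -> minimal G ->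
  (forall i k l, (phi i k l)@_0%MM = 0) -> minimal (cone s phi).
Proof.
move=> Fm Gm phim [|i] k l /=.
  by case: (split_ordP k) => a ->; rewrite ?col_mxEu ?col_mxEd.
case: (split_ordP k) => a ->; case: (split_ordP l) => b ->;
  rewrite ?block_mxEul ?block_mxEur ?block_mxEdl ?block_mxEdr ?mxE //.
- by rewrite mcoeffN Fm oppr0.
- by rewrite mcoeff0.
Qed.

Lemma cone_shift s F G
    (phi : forall i, 'M[{mpoly K[n]}]_(fr_rank F i, fr_rank G i)) z :
  has_shift (cone s phi) z <-> has_shift G z \/ has_shift F (z + 1 - s%:Z).
Proof.
split.
  case=> -[|i] [k ->] /=; first by left; exists 0%N, k.
  case: (split_ordP k) => a _.
    by right; exists i, a; lia.
  by left; exists i.+1, a.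
case=> -[i [k kE]].
  case: i k kE => [|i] k ->; first by exists 0%N, k.
  by exists i.+1, (rshift (fr_rank F i) k) => /=; rewrite (unsplitK (inr k)).
exists i.+1, (lshift (fr_rank G i.+1) k) => /=.
by rewrite (unsplitK (inl k)); lia.
Qed.

(** The homogeneous component of degree [e] of a vector in a graded free module
whose basis has degrees [dc]. *)
Section Components.
Variables (b : nat) (dc : 'I_b -> nat).
Implicit Types (v : 'rV[{mpoly K[n]}]_b).

Definition row_part e v : 'rV[{mpoly K[n]}]_b :=
  \row_l mpart (fun m => (dc l + mdeg m)%N == e) (v 0 l).

Lemma row_partP e v l m :
  m \in msupp (row_part e v 0 l) -> (dc l + mdeg m)%N = e.
Proof. by rewrite mxE msupp_mpart => /andP[/eqP]. Qed.

Lemma row_part_id e v :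
  (forall l m, m \in msupp (v 0 l) -> (dc l + mdeg m)%N = e) -> row_part e v = v.
Proof.
move=> h; apply/rowP => l; rewrite mxE mpart_id // => m /h ->; exact: eqxx.
Qed.

End Components.

Lemma row_part_mul a b (dr : 'I_a -> nat) (dc : 'I_b -> nat)
    (M : 'M[{mpoly K[n]}]_(a, b)) e v :
  graded_mx dr dc M -> row_part dc e (v *m M) = row_part dr e v *m M.
Proof.
move=> Mg; apply/rowP => l; rewrite !mxE raddf_sum /=; apply: eq_bigr => k _.
rewrite mxE; apply: mpart_mul => m m' /Mg <-; congr (_ == _); rewrite mdegD; lia.
Qed.

End Shifts.

(** Chain maps are built one homological degree at a time, and the type of each
component depends on that degree. *)
Lemma dependent_choice_seq (T : nat -> Type) (inv : forall i, T i -> Prop)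
    (next : forall i, T i -> T i.+1 -> Prop) (x0 : T 0%N) :
  inv 0%N x0 ->
  (forall i x, inv i x -> exists y, inv i.+1 y /\ next i x y) ->
  exists f : forall i, T i,
    [/\ f 0%N = x0, forall i, inv i (f i) & forall i, next i (f i) (f i.+1)].
Proof.
move=> h0 hS; pose S i := {x : T i | inv i x}.
have step i (x : S i) : {y : S i.+1 | next i (sval x) (sval y)}.
  have [y [iy ny]] := constructive_indefinite_description _ (hS i (sval x) (svalP x)).
  by exists (exist _ y iy).
pose f := fix f i : S i := if i is j.+1 then sval (step j (f j)) else exist _ x0 h0.
exists (fun i => sval (f i)); split=> // i; first exact: svalP.
exact: (svalP (step i (f i))).
Qed.

Section Lifting.
Variables (K : fieldType) (n : nat).
Implicit Types (F G : free_seq K n) (A B I P : {mpoly K[n]} -> Prop).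

(** A graded linear system with homogeneous right-hand side that is solvable
has a homogeneous solution, namely a component of any solution. *)
Lemma graded_solution a b (dr : 'I_a -> nat) (dc : 'I_b -> nat)
    (M : 'M[{mpoly K[n]}]_(a, b)) e (v : 'rV_b) : graded_mx dr dc M ->
  (forall l m, m \in msupp (v 0 l) -> (dc l + mdeg m)%N = e) ->
  (exists w, v = w *m M) ->
  exists w, v = w *m M /\ forall l m, m \in msupp (w 0 l) -> (dr l + mdeg m)%N = e.
Proof.
move=> Mg vh [w vE]; exists (row_part dr e w); split.
  by rewrite -(row_part_mul _ _ Mg) -vE row_part_id.
exact: row_partP.
Qed.

Lemma graded_mx_solution a b c (dr : 'I_a -> nat) (dc : 'I_b -> nat) (de : 'I_c -> nat)
    (M : 'M[{mpoly K[n]}]_(a, b)) (N : 'M_(c, b)) :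
  graded_mx dr dc M -> graded_mx de dc N ->
  (forall k, exists w, row k N = w *m M) ->
  exists2 X, N = X *m M & graded_mx de dr X.
Proof.
move=> Mg Ng NM.
have /fin_all_exists[X XP] k : exists w, row k N = w *m M /\
    forall l m, m \in msupp (w 0 l) -> (dr l + mdeg m)%N = de k.
  by apply: (graded_solution Mg) (NM k) => l m; rewrite mxE => /Ng.
exists (\matrix_k X k).
  by apply/row_matrixP => k; rewrite row_mul rowK (XP k).1.
by move=> k l m; rewrite mxE => /(XP k).2.
Qed.

(** Comparison theorem: multiplication by [f], as a map from A/I to B/P, lifts
to a chain map, because F is free and G is exact.  Taking homogeneous
components keeps the lift graded, which the minimality of cones relies on. *)
Lemma lift_chain_map F G A I B P s f :
  graded_maps F -> graded_maps G -> ideal_like I -> ideal_like P ->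
  homogeneous_ideal P ->
  resolves_quot F A I -> resolves_quot G B P -> f \is s.-homog ->
  (forall a, A a -> B (f * a)) ->
  (forall a, I a -> P (f * a)) ->
  exists phi : forall i, 'M[{mpoly K[n]}]_(fr_rank F i, fr_rank G i), [/\ chain_map phi,
    forall v : 'rV[{mpoly K[n]}]_(fr_rank F 0), P (augment (v *m phi 0%N) - f * augment v) &
    forall i, graded_mx (fun k => fr_deg F k + s)%N (fr_deg G (i:=i)) (phi i)].
Proof.
move=> /graded_mapsE[Fa Fg] /graded_mapsE[Ga Gg] Ii Pi Ph RF RG fs fA fI.
have [F1 F2 F3] := RF; have [G1 G2 G3] := RG.
pose gr i (M : 'M[{mpoly K[n]}]_(fr_rank F i, fr_rank G i)) :=
  graded_mx (fun k => fr_deg F k + s)%N (fr_deg G (i:=i)) M.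
pose inv i (M : 'M[{mpoly K[n]}]_(fr_rank F i, fr_rank G i)) :=
  gr i M /\ forall k, exists w, row k (fr_diff F i *m M) = w *m fr_diff G i.
have dg i (M : 'M[{mpoly K[n]}]_(fr_rank F i, fr_rank G i)) : gr i M ->
  graded_mx (fun k => fr_deg F k + s)%N (fr_deg G (i:=i)) (fr_diff F i *m M).
  move=> Mg k l m; rewrite mxE => /msupp_sum_le /flattenP[_ /mapP[j _ ->]].
  case/msuppM_le/allpairsP => -[m1 m2] /= [/Fg <- /Mg h ->].
  by rewrite mdegD; lia.
have [phi0 phi0P phi0g] : exists2 M : 'M[{mpoly K[n]}]_(fr_rank F 0, fr_rank G 0),
    forall k, P (f * fr_aug F k 0 - augment (row k M)) & gr 0%N M.
  have /fin_all_exists[X XP] k : exists w : 'rV[{mpoly K[n]}]_(fr_rank G 0),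
      P (f * fr_aug F k 0 - augment w) /\
      forall l m, m \in msupp (w 0 l) -> (fr_deg G l + mdeg m)%N = (fr_deg F k + s)%N.
    have /fA/G1[w Pw] : A (fr_aug F k 0).
      by rewrite -augment_delta; apply: resolves_quot_augment RF.
    exists (row_part (fr_deg G (i:=0%N)) (fr_deg F k + s) w).
    split; last exact: row_partP.
    have := Ph (fr_deg F k + s)%N _ Pw; rewrite raddfB /= mpart_id; last first.
      move=> m /msuppM_le/allpairsP[[m1 m2]] /= [m1f /Fa h ->].
      move/dhomogP: fs => /(_ _ m1f) /= <-.
      by rewrite mdegD -h add0n addnC.
    rewrite /augment -(row_part_mul _ _ Ga) [row_part _ _ _ 0 0]mxE; apply.
  exists (\matrix_k X k); first by move=> k; rewrite rowK; apply: (XP k).1.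
  by move=> k l m; rewrite mxE => /(XP k).2.
have phi0A (v : 'rV[{mpoly K[n]}]_(fr_rank F 0)) : P (augment (v *m phi0) - f * augment v).
  have -> : augment (v *m phi0) - f * augment v =
      \sum_k - v 0 k * (f * fr_aug F k 0 - augment (row k phi0)).
    rewrite /augment -mulmxA !mxE mulr_sumr -sumrB; apply: eq_bigr => k _.
    rewrite -row_mul [row _ _ 0 0]mxE mulrBr !mulNr opprK addrC; congr (- _ + _).
    by rewrite mulrCA.
  by apply: ideal_sum => // k _; apply: idealM.
have inv0 : inv 0%N phi0.
  split=> // k; rewrite row_mul; apply/G2.
  set u := row k _; have /fI Iu : I (augment u).
    by apply/F2; exists (delta_mx 0 k); rewrite /u rowE.
  by rewrite -[augment _](subrK (f * augment u)); apply: idealD.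
have invS i (M : 'M[{mpoly K[n]}]_(fr_rank F i, fr_rank G i)) : inv i M ->
    exists M', inv i.+1 M' /\ fr_diff F i *m M = M' *m fr_diff G i.
  case=> Mg MG; have [M' ME M'g] := graded_mx_solution (Gg i) (dg _ _ Mg) MG.
  exists M'; split=> //; split=> // k; apply/G3.
  by rewrite -row_mul -mulmxA -ME mulmxA (acyclic_dd _ F3) mul0mx row0.
have [phi [phi0E phiI phiC]] := dependent_choice_seq inv0 invS.
exists phi; split=> //; first by rewrite phi0E.
by move=> i; case: (phiI i).
Qed.

End Lifting.
(** * Minimal resolutions of quotients of monomial ideals *)
Section MonomialQuotients.
Variables (K : fieldType) (n : nat).
Implicit Types (F G C : free_seq K n) (A B I P Q : pred 'X_{1..n}).
Implicit Types (p q : {mpoly K[n]}) (m : 'X_{1..n}).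

Definition up_closed Q : Prop := forall m m', Q m -> Q (m + m')%MM.

(** [A] and [I] are sets of exponent vectors standing for the ideals that the
corresponding monomials span. *)
Definition min_resolves F A I : Prop :=
  [/\ graded_maps F, minimal F & resolves_quot F (@mon_span K n A) (@mon_span K n I)].

Lemma mon_span0 p : mon_span pred0 p <-> p = 0.
Proof.
split=> [h|->]; last by move=> m; rewrite msupp0.
apply/msuppnil0; case E: (msupp p) => [//|m s].
by have := h m; rewrite E mem_head => /(_ isT).
Qed.

Lemma mon_span_mpart Q p : mon_span Q (mpart Q p).
Proof. by move=> m; rewrite msupp_mpart => /andP[]. Qed.

Lemma mpoly_monomial_divide u p : {in msupp p, forall m, (u <= m)%MM} ->
  exists q, p = 'X_[u] * q.
Proof.
move=> h; exists (mlin (fun m => 'X_[m - u]) p); rewrite /mlin mulr_sumr.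
rewrite [LHS]mpolyE; apply: eq_big_seq => m /h um.
by rewrite -scalerAr -mpolyXD addmC submK.
Qed.

(** The sum of the ideal of [P] and of a monomial multiple of the ideal of [A],
computed on exponent vectors. *)
Lemma mon_span_sum A P P' u p : up_closed P ->
  (forall m, P' m <-> P m \/ exists2 a, A a & m = (u + a)%MM) ->
  mon_span P' p <-> exists2 a, mon_span A a & mon_span P (p - 'X_[u] * a).
Proof.
move=> Pup P'E; split=> [p'|[a Aa Pp] m].
  have [a aE] : exists a, mpart (predC P) p = 'X_[u] * a.
    apply: mpoly_monomial_divide => m; rewrite msupp_mpart => /andP[/= nP /p'].
    by case/P'E => [|[a _ ->]]; [rewrite (negPf nP)|rewrite lem_addr].
  exists a; last by rewrite [p](mpart_split P) -aE addrK; apply: mon_span_mpart.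
  suff : mon_span (fun m => A (m - u)%MM) ('X_[u] * a).
    by move/mon_spanMX; apply: mon_spanS => m; rewrite addmC addmK.
  rewrite -aE => m; rewrite msupp_mpart => /andP[/= nP /p'].
  by case/P'E => [|[b Ab ->]]; [rewrite (negPf nP)|rewrite addmC addmK].
rewrite -[p](subrK ('X_[u] * a)) => /msuppD_le; rewrite mem_cat => /orP[].
  by move/Pp => ?; apply/P'E; left.
rewrite mulrC (perm_mem (msuppMX _ _)) => /mapP[b /Aa Ab ->].
by apply/P'E; right; exists b.
Qed.

Lemma mon_cone_resolves s F G A I B P P' u
    (phi : forall i, 'M[{mpoly K[n]}]_(fr_rank F i, fr_rank G i)) :
  up_closed I -> up_closed P ->
  resolves_quot F (@mon_span K n A) (mon_span I) ->
  resolves_quot G (@mon_span K n B) (mon_span P) -> chain_map phi ->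
  (forall v, mon_span P (augment (v *m phi 0%N) - 'X_[u] * augment v)) ->
  (forall m, A m -> B (u + m)%MM) ->
  (forall m, A m -> P (u + m)%MM = I m) ->
  (forall m, P' m <-> P m \/ exists2 a, A a & m = (u + a)%MM) ->
  resolves_quot (cone s phi) (@mon_span K n B) (mon_span P').
Proof.
move=> Iup Pup RF RG phiC phi0 AB API P'E.
apply: (cone_resolves s _ _ RF RG phiC phi0).
- exact: mon_span_ideal.
- exact: mon_span_ideal.
- by move=> a Aa; apply/mon_spanMX => m /Aa /AB.
- move=> a Aa; split; last by move=> Ia; apply/mon_spanMX => m ma; rewrite API ?Ia ?Aa.
  by move/mon_spanMX => h m ma; rewrite -API ?h ?Aa.
- by move=> p; apply: mon_span_sum.
Qed.

(** The separation hypothesis says that in each homological degree all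
generators of F, once shifted, have larger degree than those of G.  A graded
comparison map then has no constant entries, so that its cone is minimal. *)
Lemma min_resolves_cone F G A I B P P' u :
  up_closed I -> up_closed P -> min_resolves F A I -> min_resolves G B P ->
  (forall m, A m -> B (u + m)%MM) ->
  (forall m, A m -> P (u + m)%MM = I m) ->
  (forall m, P' m <-> P m \/ exists2 a, A a & m = (u + a)%MM) ->
  (forall z z', has_shift F z -> has_shift G z' -> z' < z + (mdeg u)%:Z) ->
  exists2 C, min_resolves C B P' &
    forall z, has_shift C z <-> has_shift G z \/ has_shift F (z + 1 - (mdeg u)%:Z).
Proof.
move=> Iup Pup [Fg Fm RF] [Gg Gm RG] AB API P'E sep.
have [phi [phiC phi0 phig]] : exists phi : forall i, 'M[{mpoly K[n]}]_(fr_rank F i, fr_rank G i),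
  [/\ chain_map phi,
    forall v : 'rV_(fr_rank F 0), mon_span P (augment (v *m phi 0%N) - 'X_[u] * augment v) &
    forall i, graded_mx (fun k => fr_deg F k + mdeg u)%N (fr_deg G (i:=i)) (phi i)].
  apply: (lift_chain_map Fg Gg _ _ _ RF RG).
  - exact: mon_span_ideal.
  - exact: mon_span_ideal.
  - exact: mon_span_homogeneous.
  - by apply/dhomogP => m; rewrite msuppX inE => /eqP->.
  - by move=> a Aa; apply/mon_spanMX => m /Aa /AB.
  - move=> a Ia; apply/mon_spanMX => m ma; rewrite API ?Ia //.
    by apply: (resolves_quot_sub RF Ia).
exists (cone (mdeg u) phi); last by move=> z; apply: cone_shift.
split; [exact: cone_graded| |exact: mon_cone_resolves RF RG _ _ _ _ _].
apply: cone_minimal => // i k l; apply/eqP; rewrite mcoeff_eq0.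
apply/negP => /phig; rewrite mdeg0 => e.
have := sep _ _ (ex_intro _ i (ex_intro _ k erefl)) (ex_intro _ i (ex_intro _ l erefl)).
lia.
Qed.

(** F_0 is the polynomial ring itself, up to a choice of generator. *)
Definition augment_bij F : Prop :=
  (forall v : 'rV_(fr_rank F 0), augment v = 0 -> v = 0) /\
  (forall p, exists v : 'rV_(fr_rank F 0), augment v = p).

(** Independence of [A] and [I] from the variable [y] makes [y] a nonzerodivisor
on A/I, so the cone of multiplication by [y] resolves A/(I + yA).  The scalar
chain map is used rather than an abstract lift: its entries are visibly without
constant term, so no separation of degrees is needed.  Both the degree and the
homological degree go up by one, hence the unchanged shifts. *)
Lemma min_resolves_cone_var F A I (y : 'I_n) :
  up_closed I ->
  (forall m, A (U_(y) + m)%MM = A m) -> (forall m, I (U_(y) + m)%MM = I m) ->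
  min_resolves F A I -> exists C, [/\
    min_resolves C A (fun m => I m || A m && (m y != 0%N)),
    forall z, has_shift C z <-> has_shift F z & augment_bij F -> augment_bij C].
Proof.
move=> Iup Ay Iy [Fg Fm RF].
pose phi i : 'M[{mpoly K[n]}]_(fr_rank F i) := ('X_y)%:M.
exists (cone 1 phi); split=> //; last first.
  by move=> z; rewrite cone_shift addrK; tauto.
split.
- apply: cone_graded => // i k l m; rewrite mxE.
  case: eqP => [->|_]; last by rewrite msupp0.
  by rewrite mulr1n msuppX inE => /eqP->; rewrite mdeg1.
- apply: cone_minimal => // i k l; rewrite mxE mcoeffMn mcoeffX.
  by case: eqP => [/mnmP/(_ y)|]; rewrite ?mul0rn // mnm1E mnm0E eqxx.
- apply: (mon_cone_resolves 1 (u := U_(y)%MM) Iup Iup RF RF) => //.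
  + by move=> i; rewrite /phi scalar_mxC.
  + move=> v; rewrite /phi mul_mx_scalar augmentZ subrr.
    by move=> m; rewrite msupp0.
  + by move=> m; rewrite Ay.
  + move=> m; split=> [/orP[->|/andP[Am my]]|[->//|[a Aa ->]]]; first by left.
      by right; exists (m - U_(y))%MM; rewrite -?(Ay (m - _)%MM) addmC submK // lep1mP.
    by rewrite Ay Aa mnmDE mnm1E eqxx orbT.
Qed.

Definition hits (s : seq 'I_n) m : bool := has (fun i => m i != 0%N) s.

Lemma hits_up s : up_closed (hits s).
Proof.
move=> m m' /hasP[i si mi]; apply/hasP; exists i => //.
by rewrite mnmDE addn_eq0 negb_and mi.
Qed.

Lemma hitsU s (y : 'I_n) m : y \notin s -> hits s (U_(y) + m)%MM = hits s m.
Proof.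
move=> ys; apply: eq_in_has => i si; rewrite mnmDE mnm1E.
by case: (y =P i) ys => [->|]; rewrite ?si.
Qed.

(** Tensoring with the Koszul complex of variables on which A does not depend:
A/0 becomes A/(ys)A, and (ys)A consists of the monomials of A divisible by a
variable in [ys]. *)
Lemma min_resolves_koszul F A (ys : seq 'I_n) : up_closed A -> uniq ys ->
  (forall y m, y \in ys -> A (U_(y) + m)%MM = A m) ->
  min_resolves F A pred0 -> exists C, [/\
    min_resolves C A (predI A (hits ys)),
    forall z, has_shift C z <-> has_shift F z & augment_bij F -> augment_bij C].
Proof.
move=> Aup; elim: ys => [_ _|y ys IH /= /andP[yys uys] Ay] RF.
  exists F; split=> //; case: RF => ? ? RF; split=> //.
  by apply: resolves_quot_ext RF => // p; split; apply: mon_spanS => m //=; rewrite andbF.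
have [|C [RC Csh Cbij]] := IH uys _ RF.
  by move=> z m zys; apply: Ay; rewrite inE zys orbT.
have [|||D [RD Dsh Dbij]] := min_resolves_cone_var (y := y) _ _ _ RC.
- by move=> m m' /= /andP[Am Hm]; rewrite Aup ?hits_up.
- by move=> m; apply: Ay; rewrite inE eqxx.
- by move=> m /=; rewrite hitsU // Ay // inE eqxx.
exists D; split=> [|z|/Cbij/Dbij //]; last by rewrite Dsh Csh.
case: RD => ? ? RD; split=> //; apply: resolves_quot_ext RD => // p.
by split; apply: mon_spanS => m /=; rewrite /hits /=;
  case: (A m); case: (m y != 0%N) => //=; rewrite ?orbF ?orbT.
Qed.

(** Forgetting F_0 turns a resolution of R/I into one of I. *)
Definition truncate F : free_seq K n :=
  @FreeSeq K n (fun i => fr_rank F i.+1) (fun i k => fr_deg F k)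
    (fun i => fr_diff F i.+1) (fr_diff F 0 *m fr_aug F).

Lemma augment_truncate F (v : 'rV_(fr_rank F 1)) :
  augment (v : 'rV_(fr_rank (truncate F) 0)) = augment (v *m fr_diff F 0).
Proof. by rewrite /augment mulmxA. Qed.

Lemma min_resolves_truncate F I : up_closed I -> augment_bij F ->
  min_resolves F predT I -> min_resolves (truncate F) I pred0.
Proof.
move=> Iup [Finj Fsurj] [/graded_mapsE[Fa Fg] Fm RF].
have [F1 F2 F3] := RF; split.
- apply/graded_mapsE; split=> [k l m|i]; last exact: Fg.
  rewrite mxE => /msupp_sum_le /flattenP[_ /mapP[j _ ->]].
  case/msuppM_le/allpairsP => -[m1 m2] /= [/Fg <- /Fa <- ->].
  by rewrite !add0n mdegD addnC.
- by move=> i k l; apply: Fm.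
- split=> [p|v|i v]; last exact: F3.
  + split=> [Ip|[v /mon_span0/eqP]].
      have [u uE] := Fsurj p; have [w wE] : exists w, u = w *m fr_diff F 0.
        by apply/F2; rewrite uE.
      by exists w; rewrite augment_truncate -wE uE subrr; apply/mon_span0.
    by rewrite subr_eq0 => /eqP->; rewrite augment_truncate; apply/F2; exists v.
  + change (mon_span pred0 (augment (v : 'rV_(fr_rank (truncate F) 0))) <->
      exists w : 'rV_(fr_rank F 2), (v : 'rV_(fr_rank F 1)) = w *m fr_diff F 1).
    rewrite -F3 augment_truncate mon_span0; split=> [/Finj //|->].
    exact: augment0.
Qed.

Definition dsum_deg F G i (k : 'I_(fr_rank F i + fr_rank G i)) : nat :=
  match split k with inl a => fr_deg F a | inr b => fr_deg G b end.

Definition dsum F G : free_seq K n :=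
  @FreeSeq K n (fun i => fr_rank F i + fr_rank G i)%N (@dsum_deg F G)
    (fun i => block_mx (fr_diff F i) 0 0 (fr_diff G i)) (col_mx (fr_aug F) (fr_aug G)).

Lemma augment_dsum F G (u : 'rV_(fr_rank F 0)) (v : 'rV_(fr_rank G 0)) :
  augment (row_mx u v : 'rV_(fr_rank (dsum F G) 0)) = augment u + augment v.
Proof. by rewrite /augment mul_row_col mxE. Qed.

(** If the intersection of A and B is inside I, the images of A and B modulo I
are independent, since no cancellation between monomials can occur outside
I. *)
Lemma mon_span_indep I A B p q : (forall m, A m -> B m -> I m) ->
  mon_span A p -> mon_span B q -> mon_span I (p + q) -> mon_span I p.
Proof.
move=> ABI Ap Bq Ipq m mp; case: (boolP (m \in msupp q)) => mq.
  by apply: ABI; [apply: Ap|apply: Bq].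
by apply: Ipq; rewrite mcoeff_msupp mcoeffD (memN_msupp_eq0 mq) addr0 -mcoeff_msupp.
Qed.

Lemma min_resolves_dsum F G A B I : up_closed I ->
  (forall m, A m -> B m -> I m) -> min_resolves F A I -> min_resolves G B I ->
  min_resolves (dsum F G) (predU A B) I.
Proof.
move=> Iup ABI [Fg Fm RF] [Gg Gm RG].
have [[F1 F2 F3] [G1 G2 G3]] := (RF, RG).
have Ii : ideal_like (@mon_span K n I) by apply: mon_span_ideal.
split.
- move: Fg Gg => /graded_mapsE[Fa Fg] /graded_mapsE[Ga Gg].
  apply/graded_mapsE; split=> [k l m|i k l m] /=; rewrite /dsum_deg.
    by case: (split_ordP k) => a ->; rewrite ?col_mxEu ?col_mxEd; [move/Fa|move/Ga].
  case: (split_ordP k) => a ->; case: (split_ordP l) => b ->;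
    rewrite ?block_mxEul ?block_mxEur ?block_mxEdl ?block_mxEdr ?mxE ?msupp0 //.
    by move/Fg.
  by move/Gg.
- move=> i k l /=.
  case: (split_ordP k) => a ->; case: (split_ordP l) => b ->;
    rewrite ?block_mxEul ?block_mxEur ?block_mxEdl ?block_mxEdr ?mxE ?mcoeff0 //.
split.
- move=> p; split=> [ABp|[v]].
    have /F1[u Iu] := mon_span_mpart (Q := A) (p := p).
    have /G1[v Iv] : mon_span B (mpart (predC A) p).
      move=> m; rewrite msupp_mpart => /andP[/= nA /ABp /=].
      by rewrite (negPf nA).
    exists (row_mx u v); rewrite augment_dsum {1}(mpart_split A p) opprD addrACA.
    exact: (idealD Ii).
  rewrite -[v](hsubmxK (v : 'rV_(_ + _))) augment_dsum.
  move: (lsubmx _) (rsubmx _) => a b Ip.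
  rewrite -[p](subrK (augment a + augment b)).
  move=> m /msuppD_le; rewrite mem_cat => /orP[mp|].
    by apply/orP; left; apply: (resolves_quot_sub RF Ip).
  move/msuppD_le; rewrite mem_cat => /orP[] /=.
    by move/(resolves_quot_augment a Ii RF) => ->.
  by move/(resolves_quot_augment b Ii RG) => ->; rewrite orbT.
- change (forall v : 'rV_(fr_rank F 0 + fr_rank G 0),
    mon_span I (augment (v : 'rV_(fr_rank (dsum F G) 0))) <->
    exists w : 'rV_(fr_rank F 1 + fr_rank G 1),
      v = w *m block_mx (fr_diff F 0) 0 0 (fr_diff G 0)).
  move=> v; rewrite -[v]hsubmxK augment_dsum; move: (lsubmx v) (rsubmx v) => a b.
  have Aa := resolves_quot_augment a Ii RF; have Bb := resolves_quot_augment b Ii RG.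
  split=> [Iab|[w]].
    have /F2[c ->] := mon_span_indep ABI Aa Bb Iab.
    have /G2[d ->] : mon_span I (augment b).
      by rewrite addrC in Iab; apply: mon_span_indep Bb Aa Iab => m ? ?; apply: ABI.
    by exists (row_mx c d); rewrite mul_row_block !mulmx0 addr0 add0r.
  rewrite -[w]hsubmxK mul_row_block !mulmx0 addr0 add0r => /eq_row_mx[-> ->].
  by apply: (idealD Ii); [apply/F2|apply/G2]; eexists.
- move=> i v; rewrite -[v](hsubmxK (v : 'rV_(_ + _))) /=.
  move: (lsubmx _) (rsubmx _) => a b.
  rewrite mul_row_block !mulmx0 addr0 add0r; split=> [|[w]].
    rewrite -row_mx0 => /eq_row_mx[/F3[c ->] /G3[d ->]].
    by exists (row_mx c d); rewrite mul_row_block !mulmx0 addr0 add0r.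
  rewrite -(hsubmxK (w : 'rV_(_ + _))) mul_row_block !mulmx0 addr0 add0r.
  case/eq_row_mx => -> ->.
  by rewrite -!mulmxA (acyclic_dd _ F3) (acyclic_dd _ G3) !mulmx0 row_mx0.
Qed.

Lemma dsum_shift F G z : has_shift (dsum F G) z <-> has_shift F z \/ has_shift G z.
Proof.
split=> [[i [k ->]] /=|].
  rewrite /dsum_deg; case: (split_ordP k) => a _; [left|right]; by exists i, a.
case=> -[i [k ->]].
  by exists i, (lshift (fr_rank G i) k) => /=; rewrite /dsum_deg (unsplitK (inl k)).
by exists i, (rshift (fr_rank F i) k) => /=; rewrite /dsum_deg (unsplitK (inr k)).
Qed.

(** Second isomorphism theorem: when I is the intersection of A and P, the
quotient A/I is (A + P)/P, so the same complex resolves both. *)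
Lemma min_resolves_add F A I P : up_closed I -> up_closed P ->
  (forall m, A m -> P m = I m) ->
  min_resolves F A I -> min_resolves F (predU A P) P.
Proof.
move=> Iup Pup API [Fg Fm RF]; have [F1 F2 F3] := RF; split=> //.
have Ii : ideal_like (@mon_span K n I) by apply: mon_span_ideal.
have Pi : ideal_like (@mon_span K n P) by apply: mon_span_ideal.
have IP p : mon_span I p -> mon_span P p.
  by move=> Ip m mp; rewrite API ?Ip //; apply: (resolves_quot_sub RF Ip).
split=> [p|v|//].
  split=> [APp|[v Pv]].
    have /F1[v Iv] := mon_span_mpart (Q := A) (p := p).
    exists v; rewrite {1}(mpart_split A p) addrAC; apply: (idealD Pi).
      exact: IP.
    move=> m; rewrite msupp_mpart => /andP[/= nA /APp /=].
    by rewrite (negPf nA).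
  rewrite -[p](subrK (augment v)) => m /msuppD_le; rewrite mem_cat => /orP[|] /=.
    by move/Pv => ->; rewrite orbT.
  by move/(resolves_quot_augment v Ii RF) => ->.
rewrite -F2; split=> [Pv m mv|/IP //].
by rewrite -API ?Pv //; exact: (resolves_quot_augment v Ii RF _ mv).
Qed.

(** The resolution of the polynomial ring by itself. *)
Definition trivial_seq : free_seq K n :=
  @FreeSeq K n (fun i => (i == 0)%N) (fun _ _ => 0%N) (fun _ => 0) (const_mx 1).

Lemma augment_trivial (v : 'rV_(fr_rank trivial_seq 0)) : augment v = v 0 0.
Proof. by rewrite /augment mxE (big_ord_recl 0) big_ord0 mxE mulr1 addr0. Qed.

Lemma augment_bij_trivial : augment_bij trivial_seq.
Proof.
split=> [v|p]; first by rewrite augment_trivial => v0; apply/rowP => k; rewrite (ord1 k) v0 mxE.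
by exists (const_mx p); rewrite augment_trivial mxE.
Qed.

Lemma min_resolves_trivial : min_resolves trivial_seq predT pred0.
Proof.
have [inj surj] := augment_bij_trivial; split.
- by apply/graded_mapsE; split=> [k l m|i k l m]; rewrite mxE ?msupp0 // msupp1 inE => /eqP->;
    rewrite mdeg0.
- by move=> i k l; rewrite mxE mcoeff0.
split=> [p|v|i v].
- split=> // _; have [v vE] := surj p; exists v.
  by rewrite vE subrr; apply/mon_span0.
- rewrite mon_span0; split=> [/inj ->|[w ->]]; first by exists 0; rewrite mul0mx.
  by rewrite mulmx0 augment0.
- split=> _; last by rewrite mulmx0.
  by exists 0; apply/rowP => -[].
Qed.

Lemma trivial_shift z : has_shift trivial_seq z <-> z = 0.
Proof.
split=> [[[|i] [k ->]]|->]; [by []|by case: k|].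
by exists 0%N, ord0.
Qed.

End MonomialQuotients.
(** * Extending the set of variables *)

(** The variables of the small ring are sent to those of the large ring by the
injection [sg].  An exponent vector of the large ring is the sum of its old part
([mpush] of [mpull]) and of the part [moff] in the new variables. *)
Section BaseChange.
Variables (K : fieldType) (n N : nat) (sg : 'I_n -> 'I_N).
Hypothesis sg_inj : injective sg.
Implicit Types (F : free_seq K n) (A I Q : pred 'X_{1..n}).

Definition mpush (m : 'X_{1..n}) : 'X_{1..N} := (\sum_i U_(sg i) *+ m i)%MM.
Definition mpull (m : 'X_{1..N}) : 'X_{1..n} := [multinom m (sg i) | i < n].
Definition moff (m : 'X_{1..N}) : 'X_{1..N} :=
  [multinom if j \in codom sg then 0%N else m j | j < N].

Lemma mpushE m i : mpush m (sg i) = m i.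
Proof.
rewrite /mpush mnm_sumE (bigD1 i) //= mulmnE mnm1E eqxx mul1n big1 ?addn0 // => j ji.
by rewrite mulmnE mnm1E (inj_eq sg_inj) (negPf ji).
Qed.

Lemma mpush_off m j : j \notin codom sg -> mpush m j = 0%N.
Proof.
move=> jN; rewrite /mpush mnm_sumE big1 // => i _; rewrite mulmnE mnm1E.
by case: eqP jN => [<-|]; rewrite ?codom_f.
Qed.

Lemma mdeg_mpush m : mdeg (mpush m) = mdeg m.
Proof.
rewrite /mpush mdeg_sum mdegE; apply: eq_bigr => i _.
by rewrite mdegMn mdeg1 mul1n.
Qed.

Lemma mpull_pushD a m : mpull (mpush a + m)%MM = (a + mpull m)%MM.
Proof. by apply/mnmP => i; rewrite mnmE !mnmDE mpushE mnmE. Qed.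

Lemma moff_pushD a m : moff (mpush a + m)%MM = moff m.
Proof.
apply/mnmP => j; rewrite !mnmE; case: ifPn => // jN.
by rewrite mpush_off.
Qed.

Lemma mpush_pull_off m : (mpush (mpull m) + moff m)%MM = m.
Proof.
apply/mnmP => j; rewrite mnmDE [moff m j]mnmE; case: ifPn => [/codomP[i ->]|jN].
  by rewrite mpushE mnmE addn0.
by rewrite mpush_off.
Qed.

Lemma mpullD m m' : mpull (m + m')%MM = (mpull m + mpull m')%MM.
Proof. by apply/mnmP => i; rewrite mnmE !mnmDE !mnmE. Qed.

Definition extend : {mpoly K[n]} -> {mpoly K[N]} :=
  comp_mpoly [tuple 'X_(sg i) | i < n].

HB.instance Definition _ := GRing.RMorphism.on extend.
HB.instance Definition _ := GRing.Linear.on extend.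

Lemma extendX m : extend 'X_[m] = 'X_[mpush m].
Proof.
rewrite /extend comp_mpolyX /mpush -mprodXnE.
by apply: eq_bigr => i _; rewrite tnth_mktuple.
Qed.

Lemma msupp_extend p m : m \in msupp (extend p) -> exists2 a, a \in msupp p & m = mpush a.
Proof.
rewrite {1}(mpolyE p) raddf_sum /= => /msupp_sum_le /flattenP[_ /mapP[a ap ->]].
rewrite filter_predT in ap; rewrite linearZ /= extendX => /msuppZ_le.
by rewrite msuppX inE => /eqP->; exists a.
Qed.

(** The coefficient, in the small ring, of the monomial [b] in the new
variables.  The large ring is free over the small one on these monomials, and
slicing is linear over the small ring ([slice_mul]); this is flatness made
concrete. *)
Definition slice (b : 'X_{1..N}) : {mpoly K[N]} -> {mpoly K[n]} :=
  mlin (fun m => if moff m == b then 'X_[mpull m] else 0).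
HB.instance Definition _ b := GRing.Linear.on (slice b).

Lemma sliceX b m : slice b 'X_[m] = if moff m == b then 'X_[mpull m] else 0.
Proof. exact: mlinX. Qed.

Lemma msupp_slice b p a : a \in msupp (slice b p) -> exists2 m, m \in msupp p & a = mpull m.
Proof.
rewrite /slice /mlin => /msupp_sum_le /flattenP[_ /mapP[m mp ->]].
rewrite filter_predT in mp; move/msuppZ_le; case: ifP => _; last by rewrite msupp0.
by rewrite msuppX inE => /eqP->; exists m.
Qed.

Lemma slice_mul b p a : slice b (p * extend a) = slice b p * a.
Proof.
rewrite [in LHS](mpolyE p) mulr_suml raddf_sum /=.
rewrite [in RHS]/slice /mlin mulr_suml; apply: eq_bigr => m _.
rewrite -!scalerAl linearZ /=; congr (_ *: _).
rewrite {1}(mpolyE a) raddf_sum mulr_sumr raddf_sum /=.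
rewrite [in RHS](mpolyE a) mulr_sumr; apply: eq_bigr => k _.
rewrite linearZ /= -!scalerAr linearZ /= extendX -mpolyXD sliceX addmC.
rewrite moff_pushD mpull_pushD; congr (_ *: _).
by case: ifP; rewrite ?mul0r // mpolyXD mulrC.
Qed.

Lemma slice_sum (s : seq 'X_{1..N}) p : uniq s -> {in msupp p, forall m, moff m \in s} ->
  p = \sum_(b <- s) 'X_[b] * extend (slice b p).
Proof.
move=> us ps.
under eq_bigr => b _ do rewrite /slice /mlin raddf_sum mulr_sumr.
rewrite exchange_big /= {1}(mpolyE p); apply: eq_big_seq => m /ps ms.
rewrite (bigD1_seq (moff m)) //= eqxx big1 ?addr0 => [|b bm].
  by rewrite linearZ /= extendX -scalerAr -mpolyXD addmC mpush_pull_off.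
by rewrite eq_sym (negPf bm) scaler0 raddf0 mulr0.
Qed.

Lemma map_slice_mul b a c (v : 'M[{mpoly K[N]}]_(a, c)) d (M : 'M[{mpoly K[n]}]_(c, d)) :
  map_mx (slice b) (v *m map_mx extend M) = map_mx (slice b) v *m M.
Proof.
apply/matrixP => i j; rewrite !mxE raddf_sum /=; apply: eq_bigr => k _.
by rewrite !mxE slice_mul.
Qed.

Lemma map_slice_sum c (v : 'rV[{mpoly K[N]}]_c) : exists2 s, uniq s &
  v = \sum_(b <- s) 'X_[b] *: map_mx extend (map_mx (slice b) v).
Proof.
exists (undup (flatten [seq map moff (msupp (v 0 k)) | k : 'I_c])); first exact: undup_uniq.
apply/rowP => k; rewrite summxE.
under eq_bigr => b _ do rewrite !mxE.
apply: slice_sum; first exact: undup_uniq.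
move=> m mv; rewrite mem_undup; apply/flatten_mapP; exists k; first by rewrite mem_enum.
exact: map_f.
Qed.

(** A linear system with coefficients in the small ring is solved over the large
ring by solving it slice by slice. *)
Lemma solve_by_slices a c (M : 'M[{mpoly K[n]}]_(a, c)) (v : 'rV_c) :
  (forall b, exists w, map_mx (slice b) v = w *m M) ->
  exists w, v = w *m map_mx extend M.
Proof.
move=> h; have [s _ vE] := map_slice_sum v.
pose W b := proj1_sig (constructive_indefinite_description _ (h b)).
have WE b : map_mx (slice b) v = W b *m M by rewrite /W; case: constructive_indefinite_description.
exists (\sum_(b <- s) 'X_[b] *: map_mx extend (W b)).
rewrite {1}vE mulmx_suml; apply: eq_bigr => b _.
by rewrite WE map_mxM scalemxAl.
Qed.

Lemma mon_span_extend Q p : mon_span Q p -> mon_span (Q \o mpull) (extend p).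
Proof.
move=> Qp m /msupp_extend[a /Qp Qa ->] /=.
rewrite -[mpush a]addm0 mpull_pushD (_ : mpull 0 = 0%MM) ?addm0 //.
by apply/mnmP => i; rewrite !mnmE.
Qed.

Lemma up_closed_pull Q : up_closed Q -> up_closed (Q \o mpull).
Proof. by move=> Qup m m' /= Qm; rewrite mpullD Qup. Qed.

Lemma mon_span_slice Q p : up_closed Q ->
  mon_span (Q \o mpull) p <-> forall b, mon_span Q (slice b p).
Proof.
move=> Qup; split=> [Qp b a /msupp_slice[m /Qp ? ->] //|h].
have Qi : ideal_like (@mon_span K N (Q \o mpull)).
  exact/mon_span_ideal/up_closed_pull.
rewrite (slice_sum (s := undup (map moff (msupp p))) (p := p)) ?undup_uniq //; last first.
  by move=> m mp; rewrite mem_undup map_f.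
by apply: (ideal_sum Qi) => b _; apply: (idealM Qi); apply: mon_span_extend.
Qed.

Definition base_change F : free_seq K N :=
  @FreeSeq K N (fr_rank F) (fun i k => fr_deg F k)
    (fun i => map_mx extend (fr_diff F i)) (map_mx extend (fr_aug F)).

Lemma slice_augment F b (v : 'rV[{mpoly K[N]}]_(fr_rank F 0)) :
  slice b (augment (v : 'rV_(fr_rank (base_change F) 0))) =
  augment (map_mx (slice b) v : 'rV_(fr_rank F 0)).
Proof. by rewrite /augment -map_slice_mul [in RHS]mxE. Qed.

Lemma augment_extend F (v : 'rV_(fr_rank F 0)) :
  augment (map_mx extend v : 'rV_(fr_rank (base_change F) 0)) = extend (augment v).
Proof. by rewrite /augment /= -map_mxM mxE. Qed.

Lemma base_change_resolves F A I : up_closed A -> up_closed I ->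
  resolves_quot F (@mon_span K n A) (@mon_span K n I) ->
  resolves_quot (base_change F) (@mon_span K N (A \o mpull)) (mon_span (I \o mpull)).
Proof.
move=> Aup Iup [F1 F2 F3].
have Ii : ideal_like (@mon_span K N (I \o mpull)).
  exact/mon_span_ideal/up_closed_pull.
have solve i (v : 'rV[{mpoly K[N]}]_(fr_rank F i)) :
    (forall b, exists w, map_mx (slice b) v = w *m fr_diff F i) <->
    exists w, v = w *m map_mx extend (fr_diff F i).
  split=> [|[w ->] b]; first exact: solve_by_slices.
  by rewrite map_slice_mul; eexists.
split=> [p|v|i v].
- rewrite mon_span_slice //; split=> [Ap|[v] /mon_span_slice Iv b]; last first.
    apply/F1; exists (map_mx (slice b) v); rewrite -slice_augment -raddfB /=.
    exact: Iv.
  have h b := (F1 _).1 (Ap b).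
  pose W b := proj1_sig (constructive_indefinite_description _ (h b)).
  have WP b : mon_span I (slice b p - augment (W b)).
    by rewrite /W; case: constructive_indefinite_description.
  pose s := undup (map moff (msupp p)).
  exists (\sum_(b <- s) 'X_[b] *: map_mx extend (W b)).
  have -> : augment (\sum_(b <- s) 'X_[b] *: map_mx extend (W b) :
      'rV_(fr_rank (base_change F) 0)) = \sum_(b <- s) 'X_[b] * extend (augment (W b)).
    rewrite {1}/augment mulmx_suml summxE; apply: eq_bigr => b _.
    by rewrite -augment_extend -augmentZ.
  rewrite {1}(slice_sum (s := s) (p := p)) ?undup_uniq //; last first.
    by move=> m mp; rewrite mem_undup map_f.
  rewrite -sumrB; apply: (ideal_sum Ii) => b _; rewrite -mulrBr -raddfB.
  by apply: (idealM Ii); apply: mon_span_extend.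
- rewrite mon_span_slice // -(solve 0%N v).
  by split=> h b; [apply/F2; rewrite -slice_augment|rewrite slice_augment; apply/F2].
- split=> [v0|[w ->]]; last first.
    by rewrite /= -mulmxA -map_mxM (acyclic_dd _ F3) raddf0 mulmx0.
  apply/(solve i.+1 v) => b; apply/F3; rewrite -map_slice_mul.
  by rewrite (v0 : v *m map_mx extend (fr_diff F i) = 0) raddf0.
Qed.

Lemma min_resolves_base_change F A I : up_closed A -> up_closed I ->
  min_resolves F A I -> min_resolves (base_change F) (A \o mpull) (I \o mpull).
Proof.
move=> Aup Iup [/graded_mapsE[Fa Fg] Fm RF]; split; last exact: base_change_resolves.
  apply/graded_mapsE; split=> [k l m|i k l m]; rewrite mxE => /msupp_extend[a ap ->];
    rewrite mdeg_mpush; [exact: Fa ap|exact: Fg ap].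
move=> i k l; apply/eqP; rewrite mcoeff_eq0 mxE; apply/negP => /msupp_extend[a ap a0].
move: ap; rewrite mcoeff_msupp; suff -> : a = 0%MM by rewrite Fm eqxx.
by apply/eqP; rewrite -mdeg_eq0 -mdeg_mpush -a0 mdeg0.
Qed.

End BaseChange.

(** * Degree bounds forced by minimality *)
Section MinimalFacts.
Variables (K : fieldType) (n : nat).
Implicit Types (F : free_seq K n) (A I : pred 'X_{1..n}).

Lemma delta_not_in_image F i (k : 'I_(fr_rank F i)) (w : 'rV_(fr_rank F i.+1)) :
  minimal F -> delta_mx 0 k = w *m fr_diff F i -> False.
Proof.
move=> Fm /matrixP/(_ 0 k)/(congr1 (mcoeff 0%MM)); rewrite !mxE !eqxx mcoeff1 eqxx.
rewrite raddf_sum big1 => [/eqP|j _ /=]; first by rewrite oner_eq0.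
by rewrite (rmorphM (mcoeff 0%MM)) /= Fm mulr0.
Qed.

(** Nakayama, made explicit: surjectivity onto R/I, with I proper, makes some
entry of the augmentation a nonzero constant; any further basis vector of F_0
could be corrected by a multiple of that one into a vector of the kernel with a
coordinate 1, against minimality. *)
Lemma min_resolves_proper F I : ~~ I 0%MM -> min_resolves F predT I ->
  augment_bij F /\ forall k : 'I_(fr_rank F 0), fr_deg F k = 0%N.
Proof.
move=> nI [/graded_mapsE[Fa _] Fm [F1 F2 _]].
have /F1[v Iv] : mon_span predT (1 : {mpoly K[n]}) by [].
have v1 : (augment v)@_0%MM = 1.
  have : (1 - augment v)@_0%MM == 0 by rewrite mcoeff_eq0; apply: contra nI => /Iv.
  by rewrite mcoeffB mcoeff1 eqxx subr_eq0 => /eqP.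
(* Evaluating [augment v] at the origin leaves the constant terms only. *)
have [k ck] : exists k, (fr_aug F k 0)@_0%MM != 0.
  apply/existsP; apply: contra_eqT v1; rewrite negb_exists => /forallP h.
  rewrite /augment mxE raddf_sum big1 1?eq_sym ?oner_eq0 // => k _ /=.
  by move: (h k); rewrite negbK (rmorphM (mcoeff 0%MM)) /= => /eqP->; rewrite mulr0.
have dk : fr_deg F k = 0%N by rewrite -(Fa k 0 0%MM) ?mdeg0 // mcoeff_msupp.
set c := (fr_aug F k 0)@_0%MM in ck.
have augk : fr_aug F k 0 = c%:MP.
  apply/mpolyP => m; rewrite mcoeffC; case: eqP => [->|/eqP m0]; first by rewrite mulr1.
  rewrite mulr0; apply/eqP; rewrite mcoeff_eq0; apply: contra m0 => /Fa.
  by rewrite dk add0n => /eqP; rewrite mdeg_eq0.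
have cV : c^-1%:MP * c%:MP = 1 :> {mpoly K[n]} by rewrite -mpolyCM mulVf.
have all_k l : l = k.
  apply/eqP/negPn/negP => lk.
  pose u : 'rV_(fr_rank F 0) := delta_mx 0 l - (fr_aug F l 0 * c^-1%:MP) *: delta_mx 0 k.
  have /F2[w wE] : mon_span I (augment u).
    rewrite augmentD augmentN augmentZ !augment_delta augk -mulrA cV mulr1 subrr.
    by move=> m; rewrite msupp0.
  have := congr1 (fun x : 'rV_(fr_rank F 0) => (x 0 l)@_0%MM) wE.
  rewrite !mxE !eqxx /= (negPf lk) mulr0 subr0 mcoeff1 eqxx.
  rewrite raddf_sum big1 => [/eqP|j _ /=]; first by rewrite oner_eq0.
  by rewrite (rmorphM (mcoeff 0%MM)) /= Fm mulr0.
have augE (u : 'rV_(fr_rank F 0)) : augment u = u 0 k * c%:MP.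
  rewrite /augment mxE (bigD1 k) //= big1 ?addr0 ?augk // => l.
  by rewrite (all_k l) eqxx.
split; last by move=> l; rewrite (all_k l).
split=> [u u0|p].
  apply/rowP => l; rewrite (all_k l) mxE; move: u0; rewrite augE => u0.
  by rewrite -[u 0 k]mulr1 -cV mulrCA u0 mulr0.
exists (const_mx (p * c^-1%:MP)); rewrite augE mxE.
by rewrite -mulrA cV mulr1.
Qed.

(** By minimality no differential kills a basis vector, so degrees increase
strictly with the homological degree, starting from the degree of some monomial
of A. *)
Lemma min_resolves_shift_ge F A d : min_resolves F A pred0 ->
  (forall m, A m -> (d <= mdeg m)%N) -> forall z, has_shift F z -> d%:Z <= z.
Proof.
move=> [/graded_mapsE[Fa Fg] Fm RF] Ad.
have [F1 F2 F3] := RF.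
have Z : ideal_like (@mon_span K n pred0) by apply: mon_span_ideal.
suff h i (k : 'I_(fr_rank F i)) : (d + i <= fr_deg F k)%N.
  by move=> z [i [k ->]]; move: (h i k); lia.
elim: i k => [|i IH] k.
  have : fr_aug F k 0 != 0.
    apply/eqP => a0; have /F2[w] : mon_span pred0 (augment (delta_mx 0 k : 'rV_(fr_rank F 0))).
      by rewrite augment_delta a0; apply/mon_span0.
    exact: delta_not_in_image.
  rewrite -msupp_eq0; case E: (msupp (fr_aug F k 0)) => [//|m s] _.
  have mk : m \in msupp (fr_aug F k 0) by rewrite E mem_head.
  rewrite -(Fa _ _ _ mk) add0n addn0; apply: Ad.
  have := resolves_quot_augment (delta_mx 0 k) Z RF.
  by rewrite augment_delta; apply.
have : row k (fr_diff F i) != 0.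
  apply/eqP => r0; have /F3[w] : (delta_mx 0 k : 'rV_(fr_rank F i.+1)) *m fr_diff F i = 0.
    by rewrite -r0 rowE.
  exact: delta_not_in_image.
case/rV0Pn => l; rewrite mxE -msupp_eq0.
case E: (msupp (fr_diff F i k l)) => [//|m s] _.
have mk : m \in msupp (fr_diff F i k l) by rewrite E mem_head.
rewrite -(Fg _ _ _ _ mk) addnS -addn1 leq_add // lt0n mdeg_eq0.
by apply: contraTneq mk => ->; rewrite -mcoeff_eq0 Fm.
Qed.

Lemma min_resolves_has_shift F A m : min_resolves F A pred0 -> A m ->
  exists z, has_shift F z.
Proof.
move=> [_ _ [F1 _ _]] Am.
have /F1[v /mon_span0/eqP] : mon_span A ('X_[m] : {mpoly K[n]}).
  by move=> k; rewrite msuppX inE => /eqP->.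
rewrite subr_eq0 => /eqP Xv.
case E: (fr_rank F 0) => [|r].
  move/(congr1 (mcoeff m)): Xv; rewrite mcoeffX eqxx /augment mxE big1 => [/eqP|k _].
    by rewrite mcoeff0 oner_eq0.
  by have := ltn_ord k; rewrite {2}E.
have k : 'I_(fr_rank F 0) by rewrite E; exact: ord0.
by eexists; exists 0%N, k.
Qed.

End MinimalFacts.

(** * Edge ideals as monomial ideals *)
Section EdgeIdeals.
Variable (K : fieldType).

Lemma ideal_gen_ideal_like n (gens : {mpoly K[n]} -> Prop) : ideal_like (ideal_gen gens).
Proof.
split.
- by exists [::]; rewrite big_nil.
- move=> p q [s [sg ->]] [t [tg ->]]; exists (s ++ t); rewrite big_cat; split=> // cg.
  by rewrite mem_cat => /orP[/sg|/tg].
- move=> r p [s [sg ->]]; exists [seq (r * cg.1, cg.2) | cg <- s]; split.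
    by move=> _ /mapP[cg /sg h ->].
  by rewrite big_map mulr_sumr; apply: eq_bigr => cg _; rewrite mulrA.
Qed.

Definition has_edge (G : sgraph) (m : 'X_{1..#|G|}) : bool :=
  [exists x : G, exists y : G,
    [&& adj x y, m (enum_rank x) != 0%N & m (enum_rank y) != 0%N]].

Lemma has_edgeP (G : sgraph) (m : 'X_{1..#|G|}) :
  reflect (exists x y : G, [/\ adj x y, m (enum_rank x) != 0%N & m (enum_rank y) != 0%N])
    (has_edge m).
Proof.
apply: (iffP existsP) => [[x /existsP[y /and3P[]]]|[x [y [h1 h2 h3]]]].
  by exists x, y.
by exists x; apply/existsP; exists y; rewrite h1 h2 h3.
Qed.

Lemma has_edge_up (G : sgraph) : up_closed (@has_edge G).
Proof.
move=> m m' /has_edgeP[x [y [xy mx my]]]; apply/has_edgeP; exists x, y.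
by rewrite !mnmDE !addn_eq0 !negb_and mx my.
Qed.

Lemma has_edge_mdeg (G : sgraph) (m : 'X_{1..#|G|}) : has_edge m -> (2 <= mdeg m)%N.
Proof.
case/has_edgeP => x [y [xy mx my]].
have xNy : enum_rank y != enum_rank x.
  by rewrite (inj_eq enum_rank_inj); apply: contraTneq xy => ->; rewrite adj_irrefl.
rewrite mdegE (bigD1 (enum_rank x)) //= (bigD1 (enum_rank y)) //=.
by move: (m (enum_rank x)) (m (enum_rank y)) mx my => [|a] [|b] // _ _; lia.
Qed.

Lemma edge_ideal_mon_span (G : sgraph) p : edge_ideal K G p <-> mon_span (@has_edge G) p.
Proof.
split=> [[s [sg ->]]|pE].
  have Qi := mon_span_ideal K (@has_edge_up G).
  apply: (ideal_sum Qi) => cg /sg[x [y [xy ->]]]; apply: (idealM Qi).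
  move=> m; rewrite -mpolyXD msuppX inE => /eqP->; apply/has_edgeP; exists x, y.
  by rewrite !mnmDE !mnm1E !eqxx; split; rewrite ?add1n ?addn1.
have Ei : ideal_like (edge_ideal K G) by apply: ideal_gen_ideal_like.
rewrite (mpolyE p); apply: (ideal_sum Ei) => m /pE /has_edgeP[x [y [xy mx my]]].
have xNy : enum_rank x != enum_rank y.
  by rewrite (inj_eq enum_rank_inj); apply: contraTneq xy => ->; rewrite adj_irrefl.
have le : (U_(enum_rank x) + U_(enum_rank y) <= m)%MM.
  apply/mnm_lepP => i; rewrite mnmDE !mnm1E; case: eqP => [<-|_].
    by rewrite eq_sym (negPf xNy) addn0 lt0n.
  by case: eqP => [<-|//]; rewrite lt0n.
rewrite -(submK le) mpolyXD scalerAl; apply: (idealM Ei).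
exists [:: (1, 'X_[U_(enum_rank x) + U_(enum_rank y)])]; rewrite big_seq1 mul1r; split=> //.
by move=> cg; rewrite inE => /eqP-> /=; exists x, y; rewrite mpolyXD.
Qed.

Lemma resolves_mon_span n (F : free_seq K n) (I : {mpoly K[n]} -> Prop) Q :
  (forall p, I p <-> mon_span Q p) ->
  minimal_graded_free_resolution F I <-> min_resolves F predT Q.
Proof.
move=> IQ; split=> [[Fg [h1 h2 h3] Fm]|[Fg Fm [h1 h2 h3]]].
  split=> //; split=> //; last by move=> v; rewrite -IQ; apply: h2.
  by move=> p; split=> // _; have [v /IQ] := h1 p; exists v.
split=> //; split=> //; last by move=> v; rewrite IQ; apply: h2.
by move=> p; have [v /IQ] := (h1 p).1 (fun _ _ => isT); exists v.
Qed.

Lemma reg_quotientE n (I : {mpoly K[n]} -> Prop) r : reg_quotient I r <->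
  exists2 F, minimal_graded_free_resolution F I &
    has_shift F r /\ forall z, has_shift F z -> z <= r.
Proof.
have bE (F : free_seq K n) i j : #|[set k : 'I_(fr_rank F i) | fr_deg F k == j]| <> 0%N <->
    exists k : 'I_(fr_rank F i), fr_deg F k = j.
  split=> [/eqP|[k kj]]; last first.
    by apply/eqP; rewrite cards_eq0; apply/set0Pn; exists k; rewrite inE kj.
  by rewrite cards_eq0 => /set0Pn[k]; rewrite inE => /eqP; exists k.
split=> [[b [F FI bF] [[i [j [bij ->]]] bmax]]|[F FI [[i [k rE]] Fmax]]].
  exists F => //; split; first by move: bij; rewrite bF => /bE[k kj]; exists i, k; rewrite kj.
  by move=> z [i' [k ->]]; apply: bmax; rewrite bF; apply/bE; exists k.
exists (fun i j => #|[set k : 'I_(fr_rank F i) | fr_deg F k == j]|); first by exists F.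
split; first by exists i, (fr_deg F k); split=> //; apply/bE; exists k.
by move=> i' j /bE[k' <-]; apply: Fmax; exists i', k'.
Qed.

End EdgeIdeals.
(** * Pairwise 3-disjoint sets of edges *)
Section ThreeDisjoint.
Variable G : sgraph.
Implicit Types (x y a b : G) (e f : {set G}).

Lemma edgesP e : reflect (exists x y, adj x y /\ e = [set x; y]) (e \in edges G).
Proof.
apply: (iffP imsetP) => [[[x y]]|[x [y [xy ->]]]].
  by rewrite inE => xy ->; exists x, y.
by exists (x, y); rewrite ?inE.
Qed.

Lemma edge_nonempty e : e \in edges G -> exists x, x \in e.
Proof. by case/edgesP => x [y [_ ->]]; exists x; rewrite set21. Qed.

Lemma edge_adj e x y : e \in edges G -> x \in e -> y \in e -> x = y \/ adj x y.
Proof.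
case/edgesP => a [b [ab ->]]; rewrite !inE.
by move=> /orP[]/eqP-> /orP[]/eqP->; [left|right|right; rewrite adj_sym|left].
Qed.

(** If nothing of [e] meets or is adjacent to [f], then [e] is closed under
adjacency inside the union, so it is not everything.  Otherwise every vertex of
the union is joined to a common vertex through that contact. *)
Lemma three_disjointE e f : e \in edges G -> f \in edges G ->
  three_disjoint e f = [forall a in e, forall b in f, (a != b) && ~~ adj a b].
Proof.
move=> eE fE; pose r := induced_rel (e :|: f).
have rE x y : r x y = [&& x \in e :|: f, y \in e :|: f & adj x y] by [].
have rsym : connect_sym r.
  by apply: sym_connect_sym => x y; rewrite !rE adj_sym andbCA.
apply/idP/idP; last first.
  move=> /forall_inP sep; have [[x xe] [v vf]] := (edge_nonempty eE, edge_nonempty fE).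
  apply/exists_inP; exists x; first by rewrite inE xe.
  apply/exists_inP; exists v; first by rewrite inE vf orbT.
  apply/negP => xv; have clo : closed r (mem e).
    have half a b : r a b -> a \in e -> b \in e.
      rewrite rE !inE => /and3P[_ /orP[//|bf] ab] ae.
      by have /forall_inP/(_ b bf) := sep a ae; rewrite ab andbF.
    move=> a b rab; apply/idP/idP; apply: half => //.
    by rewrite rE adj_sym andbCA -rE.
  have ve : v \in e by rewrite -(closed_connect clo xv).
  by have /forall_inP/(_ v vf) := sep v ve; rewrite eqxx.
apply: contraTT; rewrite negb_forall_in => /exists_inP[a ae].
rewrite negb_forall_in => /exists_inP[b bf].
rewrite negb_and (negbK (a == b)) (negbK (adj a b)) => ab.
have toA c : c \in e :|: f -> connect r a c.
  have step c' d : c' \in e :|: f -> d \in e :|: f -> c' = d \/ adj c' d -> connect r c' d.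
    by move=> c'i di [->|c'd]; [exact: connect0|apply: connect1; rewrite rE c'i di].
  have ai : a \in e :|: f by rewrite inE ae.
  have bi : b \in e :|: f by rewrite inE bf orbT.
  have rab : connect r a b.
    by apply: step => //; case/orP: ab => [/eqP|]; auto.
  move=> ci; move: (ci); rewrite inE => /orP[ce|cf].
    by apply: step => //; apply: edge_adj eE _ _.
  by apply: connect_trans rab _; apply: step => //; apply: edge_adj fE _ _.
rewrite /three_disjoint /induced_disconnected negb_exists_in; apply/forall_inP => c ci.
rewrite negb_exists_in; apply/forall_inP => d di; rewrite negbK.
by apply: connect_trans (toA d di); rewrite rsym toA.
Qed.

Lemma pairwise_three_disjointP (Gam : {set {set G}}) :
  reflect ((forall e, e \in Gam -> e \in edges G) /\
    forall e f, e \in Gam -> f \in Gam -> e <> f ->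
      forall a b, a \in e -> b \in f -> a <> b /\ ~~ adj a b)
    (pairwise_three_disjoint Gam).
Proof.
apply: (iffP andP) => [[/subsetP sub /forall_inP dis]|[sub dis]].
  split=> // e f eG fG /eqP ef a b ae bf.
  have /forall_inP/(_ f fG)/implyP/(_ ef) := dis e eG.
  rewrite three_disjointE ?sub // => /forall_inP/(_ a ae)/forall_inP/(_ b bf).
  by case/andP => /eqP.
split; first exact/subsetP.
apply/forall_inP => e eG; apply/forall_inP => f fG; apply/implyP => /eqP ef.
rewrite three_disjointE ?sub //; apply/forall_inP => a ae; apply/forall_inP => b bf.
by have [/eqP -> ->] := dis e f eG fG ef a b ae bf.
Qed.

End ThreeDisjoint.

Section InducedSubgraph.
Variables (G W : sgraph) (j : G -> W).
Hypothesis j_inj : injective j.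
Hypothesis j_adj : forall x y, adj (j x) (j y) = adj x y.

Lemma imset_edge (e : {set G}) : (j @: e \in edges W) = (e \in edges G).
Proof.
apply/edgesP/edgesP => [[a [b [ab je]]]|[x [y [xy ->]]]]; last first.
  by exists (j x), (j y); rewrite j_adj imsetU1 imset_set1.
have /imsetP[x xe ax] : a \in j @: e by rewrite je set21.
have /imsetP[y ye byy] : b \in j @: e by rewrite je set22.
exists x, y; rewrite -j_adj -ax -byy; split=> //.
by apply: (imset_inj j_inj); rewrite je imsetU1 imset_set1 ax byy.
Qed.

Lemma imset_pairwise (Gam : {set {set G}}) :
  pairwise_three_disjoint [set j @: e | e : {set G} in Gam] = pairwise_three_disjoint Gam.
Proof.
apply/pairwise_three_disjointP/pairwise_three_disjointP => -[sub dis]; split.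
- by move=> e eG; rewrite -imset_edge; apply: sub; apply: imset_f.
- move=> e f eG fG ef a b ae bf.
  have [|ja jb] :=
    dis _ _ (imset_f _ eG) (imset_f _ fG) _ (j a) (j b) (imset_f _ ae) (imset_f _ bf).
    by move/(imset_inj j_inj).
  by rewrite j_adj in jb; split=> // ab; apply: ja; rewrite ab.
- by move=> _ /imsetP[e eG ->]; rewrite imset_edge sub.
- move=> _ _ /imsetP[e eG ->] /imsetP[f fG ->] ef _ _ /imsetP[a ae ->] /imsetP[b bf ->].
  have [|ab nab] := dis e f eG fG _ a b ae bf; first by move=> efE; apply: ef; rewrite efE.
  by rewrite j_adj; split=> // /j_inj.
Qed.

Lemma card_imset_edges (Gam : {set {set G}}) : #|[set j @: e | e : {set G} in Gam]| = #|Gam|.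
Proof. exact/card_imset/imset_inj. Qed.

Lemma max_three_disjoint_sub : (max_three_disjoint G <= max_three_disjoint W)%N.
Proof.
apply/bigmax_leqP => Gam; rewrite -imset_pairwise -card_imset_edges => h.
exact: leq_bigmax_cond.
Qed.

Lemma pairwise_card_sub (Gam : {set {set W}}) : pairwise_three_disjoint Gam ->
  (forall e, e \in Gam -> e \subset codom j) -> (#|Gam| <= max_three_disjoint G)%N.
Proof.
move=> GamP sub; pose Gam' := [set e : {set G} | j @: e \in Gam].
have GamE : Gam = [set j @: e | e : {set G} in Gam'].
  apply/setP => e; apply/idP/imsetP => [eG|[e']]; last by rewrite inE => h ->.
  have eE : e = j @: (j @^-1: e).
    apply/setP => w; apply/idP/imsetP => [we|[x]]; last by rewrite inE => ? ->.
    have /codomP[x wx] := subsetP (sub e eG) w we.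
    by exists x; rewrite // inE -wx.
  by exists (j @^-1: e); rewrite // inE -eE.
by rewrite GamE imset_pairwise in GamP; rewrite GamE card_imset_edges; apply: leq_bigmax_cond.
Qed.

End InducedSubgraph.

(** A set of edges not contained in one side has a vertex in H and a vertex in
G.  As all vertices of G and H are adjacent, they belong to the same edge, and
every other edge is adjacent to one of them; so the set is a single edge. *)
Lemma max_three_disjoint_prod (G H : sgraph) :
  max_three_disjoint (graph_prod G H) =
  maxn (maxn (max_three_disjoint G) (max_three_disjoint H)) ((0 < #|G|) && (0 < #|H|))%N.
Proof.
pose il : G -> graph_prod G H := inl; pose ir : H -> graph_prod G H := inr.
have il_inj : injective il by move=> ? ? [].
have ir_inj : injective ir by move=> ? ? [].
have codl (x : G) : il x \in codom il by apply: codom_f.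
have codr (x : H) : ir x \in codom ir by apply: codom_f.
apply/eqP; rewrite eqn_leq; apply/andP; split; last first.
  rewrite !geq_max (max_three_disjoint_sub (j := il)) // (max_three_disjoint_sub (j := ir)) //=.
  case: andP => // -[/card_gt0P[x _] /card_gt0P[y _]].
  have <- : #|[set [set il x; ir y]]| = true by rewrite cards1.
  apply: leq_bigmax_cond.
  apply/pairwise_three_disjointP; split=> [e|e f]; rewrite !inE => /eqP->.
    by apply/edgesP; exists (il x), (ir y).
  by move/eqP->.
apply/bigmax_leqP => Gam GamP.
case: (boolP [forall e in Gam, e \subset codom il]) => [/forall_inP h|].
  by rewrite !leq_max (pairwise_card_sub il_inj).
case: (boolP [forall e in Gam, e \subset codom ir]) => [/forall_inP h _|].
  by rewrite !leq_max (pairwise_card_sub ir_inj) ?orbT.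
rewrite !negb_forall_in.
move=> /exists_inP[f fG /subsetPn[v vf vl]] /exists_inP[e eG /subsetPn[u ue ul]].
case: v vf vl => [x|x] vf vl; last by rewrite codr in vl.
case: u ue ul => [y|y] ue ul; first by rewrite codl in ul.
have -> : (0 < #|G|)%N by apply/card_gt0P; exists x.
have -> : (0 < #|H|)%N by apply/card_gt0P; exists y.
rewrite !leq_max; apply/orP; right.
have [sub dis] := pairwise_three_disjointP _ GamP.
have ef : e = f.
  by apply/eqP/negPn/negP => /eqP/(dis e f eG fG)/(_ _ _ ue vf)[].
rewrite -ef in vf; suff /subset_leq_card : Gam \subset [set e] by rewrite cards1.
apply/subsetP => q qG; rewrite inE; apply/negPn/negP => /eqP qe.
have [[z|z] zq] := edge_nonempty (sub q qG).
  by have [_] := dis q e qG eG qe _ _ zq ue.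
by have [_] := dis q e qG eG qe _ _ zq vf.
Qed.
(** * The resolution for a product of graphs *)
Section BipartiteIdeal.
Variables (K : fieldType) (n : nat).
Implicit Types (F : free_seq K n) (xs ys : seq 'I_n).

Lemma min_resolves_eq F A A' I I' : A =1 A' -> I =1 I' ->
  min_resolves F A I -> min_resolves F A' I'.
Proof.
move=> AA II [Fg Fm RF]; split=> //; apply: resolves_quot_ext RF => p.
  by split; apply: mon_spanS => m; rewrite AA.
by split; apply: mon_spanS => m; rewrite II.
Qed.

Lemma truncate_has_shift F z : has_shift (truncate F) z -> has_shift F (z - 1).
Proof. by case=> i [k ->]; exists i.+1, k => /=; lia. Qed.

(** Truncated Koszul complex: the ideal of the variables has a linear
resolution. *)
Lemma variables_resolution xs : uniq xs -> exists2 T,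
  min_resolves (K := K) T (hits xs) pred0 & forall z, has_shift T z -> z = 1.
Proof.
move=> uxs; have [C [RC Csh Cbij]] := min_resolves_koszul
  (F := trivial_seq K n) (A := predT) (fun _ _ _ => isT) uxs (fun _ _ _ => erefl)
  (min_resolves_trivial K n).
have {}RC : min_resolves C predT (hits xs) by apply: min_resolves_eq RC.
exists (truncate C).
  by apply: min_resolves_truncate (Cbij (augment_bij_trivial K n)) RC; apply: hits_up.
by move=> z /truncate_has_shift/Csh/trivial_shift; lia.
Qed.

Lemma up_closedI A B : @up_closed n A -> up_closed B -> up_closed (predI A B).
Proof. by move=> hA hB m m' /andP[Am Bm] /=; rewrite hA ?hB. Qed.

(** The edge ideal of a complete bipartite graph has a linear resolution.  Passing
from (xs)(ys) to (xs)(y :: ys) is the cone of multiplication by [y] from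
(xs)/(xs)(ys), whose generators have one degree more than those of the quotient
already resolved. *)
Lemma bipartite_resolution xs ys : uniq xs -> uniq ys -> {in ys, forall y, y \notin xs} ->
  exists2 F, min_resolves (K := K) F predT (predI (hits xs) (hits ys)) &
    forall z, has_shift F z <-> z = 0 \/ [/\ z = 1, xs != [::] & ys != [::]].
Proof.
move=> uxs; case: (eqVneq xs [::]) => [->|xs0].
  move=> _ _; exists (trivial_seq K n).
    by apply: min_resolves_eq (min_resolves_trivial K n) => m.
  by move=> z; rewrite trivial_shift; split=> [|[|[]]] //; left.
have [T RT Tsh] := variables_resolution uxs.
elim: ys => [_ _|y ys IH /= /andP[yys uys] dis].
  exists (trivial_seq K n).
    by apply: min_resolves_eq (min_resolves_trivial K n) => m //=; rewrite andbF.
  by move=> z; rewrite trivial_shift; split=> [|[|[]]] //; left.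
have ynxs : y \notin xs by apply: dis; rewrite mem_head.
have {}dis : {in ys, forall y, y \notin xs}.
  by move=> z zys; apply: dis; rewrite inE zys orbT.
have [F RF Fsh] := IH uys dis.
have [z m zys|C [RC Csh _]] := min_resolves_koszul (@hits_up n xs) uys _ RT.
  by rewrite hitsU // dis.
have Lup : up_closed (predI (hits xs) (hits ys)) by apply: up_closedI; apply: hits_up.
have [|m /= _|m|z z' /Csh/Tsh -> /Fsh|D RD Dsh] := min_resolves_cone
  (P' := predI (hits xs) (hits (y :: ys))) (u := U_(y)%MM) Lup Lup RC RF.
- by [].
- by rewrite !hitsU.
- rewrite /= {2}/hits /= -/(hits ys m); split.
    case/andP => Hx /orP[my|Hy]; last by left; rewrite Hx Hy.
    right; exists (m - U_(y))%MM; last by rewrite addmC submK // lep1mP.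
    by rewrite -(hitsU (m - _)%MM ynxs) addmC submK // lep1mP.
  case=> [/andP[-> ->]|[a Ha ->]]; first by rewrite orbT.
  by rewrite hitsU // Ha mnmDE mnm1E eqxx.
- by rewrite mdeg1; case=> [|[]] ->.
exists D => // z; rewrite Dsh Csh Fsh mdeg1 addrK; split.
  by case=> [[->|[-> _ _]]|/Tsh ->]; [left|right|right].
case=> [->|[-> _ _]]; first by left; left.
right; case: xs xs0 {uxs ynxs dis IH RC Lup RD RF Fsh Dsh} RT => // x xs _ RT.
have [|w hw] := min_resolves_has_shift (m := U_(x)%MM) RT.
  by rewrite /hits /= mnm1E eqxx.
by rewrite -(Tsh w hw).
Qed.

End BipartiteIdeal.

(** Shifts rise by one from R/I to I, as the homological degree drops by one.
The case [r = 0] occurs exactly for graphs without edges, where the value is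
attained only at the truncated term F_0. *)
Lemma edge_ideal_resolution (K : fieldType) (G : sgraph) r :
  reg_quotient (edge_ideal K G) r ->
  exists T : free_seq K #|G|, [/\ min_resolves T (@has_edge G) pred0,
    forall z, has_shift T z -> 2 <= z /\ z <= r + 1 & r = 0 \/ has_shift T (r + 1)].
Proof.
case/reg_quotientE => F /(resolves_mon_span _ (@edge_ideal_mon_span K G)) RF [Fr Fmax].
have [|Fbij F0] := min_resolves_proper _ RF.
  by apply/has_edgeP => -[x [y [_]]]; rewrite mnm0E.
have RT := min_resolves_truncate (@has_edge_up G) Fbij RF.
exists (truncate F); split=> // [z hz|].
  split; first by apply: (min_resolves_shift_ge RT) hz => m; apply: has_edge_mdeg.
  by move/truncate_has_shift/Fmax: hz; lia.
case: Fr => -[|i] [k ->]; first by left; rewrite F0.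
by right; exists i, k => /=; lia.
Qed.

Section JoinIdeal.
Variables (K : fieldType) (G H : sgraph).
Local Notation N := #|{: G + H}|.
Definition left_var (i : 'I_#|G|) : 'I_N := enum_rank (inl (enum_val i)).
Definition right_var (i : 'I_#|H|) : 'I_N := enum_rank (inr (enum_val i)).

Lemma left_var_inj : injective left_var.
Proof. by move=> i j /enum_rank_inj[/enum_val_inj]. Qed.

Lemma right_var_inj : injective right_var.
Proof. by move=> i j /enum_rank_inj[/enum_val_inj]. Qed.

Lemma left_right_var i j : left_var i != right_var j.
Proof. by apply/eqP => /enum_rank_inj. Qed.

Lemma codom_left_right : {in codom right_var, forall y, y \notin codom left_var}.
Proof.
move=> _ /codomP[j ->]; apply/negP => /codomP[i] /esym/eqP.
by rewrite (negPf (left_right_var i j)).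
Qed.

Lemma codom_right_left : {in codom left_var, forall y, y \notin codom right_var}.
Proof.
move=> _ /codomP[i ->]; apply/negP => /codomP[j] /eqP.
by rewrite (negPf (left_right_var i j)).
Qed.

End JoinIdeal.

Lemma has_edge_pull_hits (G : sgraph) N (sg : 'I_#|G| -> 'I_N) (m : 'X_{1..N}) :
  has_edge (mpull sg m) -> hits (codom sg) m.
Proof.
case/has_edgeP => x [y [_]]; rewrite mnmE => mx _.
by apply/hasP; exists (sg (enum_rank x)); rewrite ?codom_f.
Qed.

(** The resolution of (I(G) + L)/L, isomorphic to I(G)/(ys)I(G), with the same
shifts as for I(G). *)
Lemma extended_edge_resolution (K : fieldType) (G : sgraph) r N (sg : 'I_#|G| -> 'I_N)
    (ys : seq 'I_N) (L : pred 'X_{1..N}) :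
  injective sg -> uniq ys -> {in ys, forall y, y \notin codom sg} ->
  (forall m, L m = hits (codom sg) m && hits ys m) ->
  reg_quotient (edge_ideal K G) r ->
  exists T : free_seq K N,
    [/\ min_resolves T (predU (@has_edge G \o mpull sg) L) L,
    forall z, has_shift T z -> 2 <= z /\ z <= r + 1 & r = 0 \/ has_shift T (r + 1)].
Proof.
move=> sg_inj uys dis LE /edge_ideal_resolution[T [RT Tsh Tr]].
have Eup := up_closed_pull (sg := sg) (@has_edge_up G).
have RB := min_resolves_base_change sg_inj (@has_edge_up G)
  (fun _ _ (f : false) => f) RT.
have {}RB : min_resolves (base_change sg T) (@has_edge G \o mpull sg) pred0 by [].
have [y m yys|C [RC Csh _]] := min_resolves_koszul Eup uys _ RB.
  congr has_edge; apply/mnmP => i; rewrite !mnmE.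
  by case: (y =P sg i) (dis y yys) => [->|]; rewrite ?codom_f.
exists C; split; last by case: Tr => [|h]; [left|right; apply/Csh].
- apply: (min_resolves_add _ _ _ RC).
  + by apply: up_closedI => //; apply: hits_up.
  + move=> m m'; rewrite !LE => /andP[h1 h2].
    by apply/andP; split; apply: hits_up.
  + by move=> m Em; rewrite LE /= (has_edge_pull_hits Em) (Em : has_edge _).
- by move=> z /Csh; apply: Tsh.
Qed.

(** The equality I(G*H) = I(G) + I(H) + (x)(y). *)
Lemma has_edge_prod (G H : sgraph) (m : 'X_{1..#|graph_prod G H|}) : has_edge m =
  [|| has_edge (mpull (@left_var G H) m), has_edge (mpull (@right_var G H) m) |
    hits (codom (@left_var G H)) m && hits (codom (@right_var G H)) m].
Proof.
apply/has_edgeP/or3P => [[[x|x] [[y|y] [/= xy mx my]]]|].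
- constructor 1; apply/has_edgeP; exists x, y.
  by rewrite !mnmE /left_var !enum_rankK.
- constructor 3; apply/andP; split; apply/hasP.
    by exists (left_var H (enum_rank x)); rewrite ?codom_f // /left_var enum_rankK.
  by exists (right_var G (enum_rank y)); rewrite ?codom_f // /right_var enum_rankK.
- constructor 3; apply/andP; split; apply/hasP.
    by exists (left_var H (enum_rank y)); rewrite ?codom_f // /left_var enum_rankK.
  by exists (right_var G (enum_rank x)); rewrite ?codom_f // /right_var enum_rankK.
- constructor 2; apply/has_edgeP; exists x, y.
  by rewrite !mnmE /right_var !enum_rankK.
case=> [/has_edgeP[x [y]]|/has_edgeP[x [y]]|].
- by rewrite !mnmE /left_var !enum_rankK => -[xy mx my]; exists (inl x), (inl y).
- by rewrite !mnmE /right_var !enum_rankK => -[xy mx my]; exists (inr x), (inr y).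
case/andP => /hasP[_ /codomP[i ->] mi] /hasP[_ /codomP[j ->] mj].
by exists (inl (enum_val i)), (inr (enum_val j)).
Qed.

Lemma reg_edge_ideal_prod (K : fieldType) (G H : sgraph) (rG rH : nat) :
  reg_quotient (edge_ideal K G) rG%:Z -> reg_quotient (edge_ideal K H) rH%:Z ->
  reg_quotient (edge_ideal K (graph_prod G H))
    (maxn (maxn rG rH) ((0 < #|G|) && (0 < #|H|))%N)%:Z.
Proof.
move=> regG regH; pose xs := codom (@left_var G H); pose ys := codom (@right_var G H).
have uxs : uniq xs by apply/injectiveP/left_var_inj.
have uys : uniq ys by apply/injectiveP/right_var_inj.
pose L := predI (hits xs) (hits ys).
have Lup : up_closed L by apply: up_closedI; apply: hits_up.
have [FL RL Lsh] := bipartite_resolution K uxs uys (@codom_left_right G H).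
have [TG [RG Gsh Gr]] := extended_edge_resolution (L := L) (@left_var_inj G H)
  uys (@codom_left_right G H) (fun _ => erefl) regG.
have [TH [RH Hsh Hr]] := extended_edge_resolution (L := L) (@right_var_inj G H)
  uxs (@codom_right_left G H) (fun m => andbC _ _) regH.
have GHL m : predU (@has_edge G \o mpull (@left_var G H)) L m ->
    predU (@has_edge H \o mpull (@right_var G H)) L m -> L m.
  move=> /orP[Gm|//] /orP[Hm|//]; apply/andP; split; exact: has_edge_pull_hits.
have RS := min_resolves_dsum Lup GHL RG RH.
have [m Am|m _|m|z z'|C RC Csh] := min_resolves_cone (u := 0%MM)
  (P' := @has_edge (graph_prod G H)) Lup Lup RS RL.
- by [].
- by rewrite add0m.
- rewrite has_edge_prod -/xs -/ys; split.
    case/or3P => [Gm|Hm|Lm]; [right|right|by left]; exists m; rewrite ?add0m //=.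
      by rewrite (Gm : has_edge (mpull _ _)).
    by rewrite (Hm : has_edge (mpull _ _)) orbT.
  case=> [Lm|[a Aa ->]]; first by apply/or3P; constructor 3.
  rewrite add0m; case/orP: Aa => /orP[h|h]; apply/or3P;
    [constructor 1|constructor 3|constructor 2|constructor 3]; exact: h.
- rewrite mdeg0 addr0 => /dsum_shift hz /Lsh hz'.
  have : 2 <= z by case: hz => [/Gsh[]|/Hsh[]].
  by case: hz' => [->|[-> _ _]]; lia.
have {}Csh z : has_shift C z <-> has_shift FL z \/ has_shift TG (z + 1) \/ has_shift TH (z + 1).
  by rewrite Csh dsum_shift mdeg0 subr0.
have nonempty : (0 < #|G|)%N && (0 < #|H|)%N = (xs != [::]) && (ys != [::]).
  by rewrite -!size_eq0 !size_codom !card_ord !lt0n.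
apply/reg_quotientE; exists C.
  exact/(resolves_mon_span _ (@edge_ideal_mon_span K (graph_prod G H))).
(* The shifts of the three pieces are bounded one by one; the maximum is then
   attained in whichever piece achieves it, or at F_0 when it is 0. *)
rewrite nonempty; split=> [|z /Csh[/Lsh[->|[-> -> ->]]|[/Gsh[_]|/Hsh[_]]]]; try lia.
set b := (xs != [::]) && (ys != [::]); set r := maxn _ _.
apply/Csh; have [r0|rE] : r = 0%N \/ (r = rG /\ rG <> 0%N \/ r = rH /\ rH <> 0%N \/ r = b /\ b).
- by rewrite /r {r}; case: b; lia.
- by left; apply/Lsh; left; rewrite r0.
case: rE => [[-> r0]|[[-> r0]|[-> r0]]].
- by right; left; case: Gr => // -[].
- by right; right; case: Hr => // -[].
by left; apply/Lsh; right; rewrite r0; case/andP: r0.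
Qed.

Theorem proposition1p3 (K : fieldType) (G H : sgraph) :
  reg_eq_a K G -> reg_eq_a K H -> reg_eq_a K (graph_prod G H).
Proof.
move=> regG regH; rewrite /reg_eq_a max_three_disjoint_prod.
exact: reg_edge_ideal_prod.
Qed.
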